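(* Let $G\subseteq S_n$ be a permutation group containing the cycle $(1\,2\,\dots\,n)$, acting on $\mathbb Q^n$ by permuting coordinates. Let $\vec\delta\in\mathbb Q^n$, and let $V_\delta$ be the minimal $G$-invariant subspace of $\mathbb Q^n$ containing $\vec\delta$. Then $$V_\delta=\bigoplus_{d} U_d,$$ where $d$ runs over those $d\in D(G)$ for which there exists $r\in\Psi_d$ with $(\vec\delta,\vec w_r)\neq0$.
   Context: For a divisor $d$ of $n$, $V_d\subset\mathbb Q^n$ is the subspace of $d$-periodic vectors $(v_1,\dots,v_d,v_1,\dots,v_d,\dots,v_1,\dots,v_d)$. $D(G)$ is the set of divisors $d$ of $n$ such that $V_d$ is $G$-invariant; equivalently, the residue classes mod $d$ form a block system of $G$. For $d,\tilde d\in D(G)$, $d$ covers $\tilde d$ if $\tilde d\mid d$, $\tilde d<d$, and there is no $l\in D(G)$ with $\tilde d<l<d$, $\tilde d\mid l$, $l\mid d$. For $d\in D(G)$ let $U_d=V_d\cap V_{d_1}^\perp\cap\dots\cap V_{d_\ell}^\perp$, where $d_1,\dots,d_\ell$ are all elements of $D(G)$ covered by $d$ and $\perp$ is taken with respect to the standard scalar product. Let $\varepsilon_n=e^{2\pi i/n}$ and $\vec w_k=(1,\varepsilon_n^k,\varepsilon_n^{2k},\dots,\varepsilon_n^{(n-1)k})$ for $1\le k\le n$. The pairing $(\cdot,\cdot)$ is the standard Hermitian product on $\mathbb C^n$. For $d\in D(G)$, $\Psi_d$ is the set of $r\in\{1,\dots,n\}$ such that $n/d$ divides $r$ but $n/\tilde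 d$ does not divide $r$ for every $\tilde d\in D(G)$ covered by $d$. *)

(* Defs.v *)
From HB Require Import structures.
From mathcomp Require Import all_boot all_order all_algebra all_fingroup all_field.
Set Implicit Arguments. Unset Strict Implicit. Unset Printing Implicit Defensive.
Import Order.TTheory GRing.Theory Num.Theory.
Local Open Scope ring_scope.

(* Coordinates are 0-based: index i : 'I_n stands for coordinate i+1. *)
(* Permutation action of g on row vectors: v *m perm_mx g, i.e. (v *m perm_mx g) (g i) = v i. *)

(* V_d : the d-periodic vectors, as the row space of the matrix whose j-th
   row is the indicator of the residue class of j mod d. *)
Definition Vper (n d : nat) : 'M[rat]_n :=
  \matrix_(j < n, i < n) ((i %% d == j %% d)%N)%:R.

Definition ginv (n : nat) (G : {group 'S_n}) (V : 'M[rat]_n) : bool :=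
  [forall g in G, (V *m perm_mx g <= V)%MS].

Definition inD (n : nat) (G : {group 'S_n}) (d : nat) : bool :=
  (d %| n)%N && ginv G (Vper n d).

(* d covers dt (within D(G)); candidate l ranges over 0..n, which suffices since l | d | n *)
Definition covers (n : nat) (G : {group 'S_n}) (d dt : nat) : bool :=
  [&& inD G d, inD G dt, (dt %| d)%N, (dt < d)%N &
   ~~ [exists l : 'I_n.+1,
        [&& inD G l, (dt < l)%N, (l < d)%N, (dt %| l)%N & (l %| d)%N]]].

(* U_d = V_d ∩ ⋂_{dt covered by d} V_dt^⊥ ; the orthogonal complement of the
   row space of A is kermx A^T. *)
Definition Ud (n : nat) (G : {group 'S_n}) (d : nat) : 'M[rat]_n :=
  (Vper n d :&: \bigcap_(dt < n.+1 | covers G d dt) kermx (Vper n dt)^T)%MS.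

(* r \in Psi_d (with r \in {1..n} required separately) *)
Definition inPsi (n : nat) (G : {group 'S_n}) (d r : nat) : bool :=
  ((n %/ d) %| r)%N &&
  [forall dt : 'I_n.+1, covers G d dt ==> ~~ ((n %/ dt) %| r)%N].

(* eps_n = e^{2 pi i/n} : n.-root (-1) has argument pi/n *)
Definition eps (n : nat) : algC := (n.-root (-1)) ^+ 2.

Definition hprod (n : nat) (delta : 'rV[rat]_n) (r : nat) : algC :=
  \sum_(k < n) ratr (delta 0 k) * ((eps n) ^+ (k * r))^*.

(* V_delta : the minimal G-invariant subspace containing delta = span of its G-orbit *)
Definition Vdelta (n : nat) (G : {group 'S_n}) (delta : 'rV[rat]_n) : 'M[rat]_n :=
  (\sum_(g in G) <<delta *m perm_mx g>>)%MS.

Definition contributes (n : nat) (G : {group 'S_n}) (delta : 'rV[rat]_n) (d : nat) : bool :=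
  inD G d && [exists r : 'I_n.+1, [&& (0 < r)%N, inPsi G d r & hprod delta r != 0]].

(* Main.v *)
(** Let [P] be the orthogonal projector onto the invariant subspace generated by
    [delta].  It commutes with [G], in particular with the cycle, so it is a
    circulant matrix [f (j - i)]; being a rational idempotent, [f] has Fourier
    coefficients in {0, 1}, hence by Galois conjugation [f] is invariant under
    multiplication by the units of Z/n.  The automorphism group [K] of [f] thus
    contains [G], the translations and the units, and Muzychuk's theorem on rational
    Schur rings over cyclic groups says that [f] depends only on which block
    systems of [K] separate its argument from 0.  By Moebius inversion [P] is then a
    combination of the matrices of the [V_d], [d] in D(G), each of which is scalar
    on every [U_e]; so each [U_e] lies in the subspace or is orthogonal to it.
    Since Q^n is the orthogonal sum of the [U_e], the subspace is the sum of
    those [U_e] to which [delta] is not orthogonal, and the support of the Fourier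
    transform on [U_e] is [Psi_e].

    Muzychuk's theorem is proved by induction on [n].  After rescaling to a subgroup
    and dividing by the radical, let [T] be an orbit of the stabiliser of 0 that
    generates Z/n and has trivial radical.  For a prime [p] dividing [n], counting
    the [t] in [T] with [p t = z] modulo [p] is again invariant, which yields
    [T = Y + S] with [Y] the orbit of [n/p] and [S] an orbit of elements of order
    prime to [p].  If [n/p] lies in a proper block, the induction hypothesis puts 1
    into [T]; if this happens for no [p], every such [T] contains [n/p]. *)

Require Import Defs.
From HB Require Import structures.
From mathcomp Require Import all_boot all_order all_algebra all_fingroup all_field.
From mathcomp Require Import ring.
From mathcomp Require boolp.
Set Implicit Arguments.
Unset Strict Implicit.
Unset Printing Implicit Defensive.
Import Order.TTheory GRing.Theory Num.Theory.
Local Open Scope ring_scope.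

(** * Divisibility, gcds and units modulo [n] *)

Lemma coprimez_prime_test (a : int) (n : nat) : (0 < n)%N ->
  (forall q : nat, prime q -> (q %| n)%N -> ~~ (q %| a)%Z) -> coprimez a n.
Proof.
move=> n_gt0 Hq; rewrite coprimezE /coprime eqn_leq gcdn_gt0 n_gt0 orbT andbT.
rewrite leqNgt; apply/negP => /pdivP[q q_pr]; rewrite dvdn_gcd => /andP[qa qn].
by have /negP := Hq q q_pr qn; apply; rewrite dvdzE.
Qed.

Lemma primez_mul (q : nat) (a b : int) : prime q ->
  (q %| a * b)%Z = (q %| a)%Z || (q %| b)%Z.
Proof. by move=> q_pr; rewrite !dvdzE abszM Euclid_dvdM. Qed.

Lemma prime_dvd_prod_seq (q : nat) (s : seq nat) : prime q ->
  (q %| \prod_(p <- s) p)%N -> exists2 p, p \in s & (q %| p)%N.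
Proof.
move=> q_pr; elim: s => [|p s IHs].
  by rewrite big_nil dvdn1 => /eqP q1; rewrite q1 in q_pr.
rewrite big_cons Euclid_dvdM // => /orP[qp|/IHs[r rs qr]].
  by exists p; rewrite // mem_head.
by exists r; rewrite // in_cons rs orbT.
Qed.

(** Take for [t] the product of the primes of [n] not dividing [a]: each prime of [n] then divides
    exactly one of [a] and [b * t]. *)
Lemma coprimez_shift (a b : int) (n : nat) : (0 < n)%N -> coprimez a b ->
  exists t : int, coprimez (a + b * t) n.
Proof.
move=> n_gt0 cab.
pose s := [seq p <- primes n | ~~ (p%:Z %| a)%Z].
have qs q : prime q -> (q %| n)%N -> ~~ (q%:Z %| a)%Z -> q \in s.
  by move=> q_pr qn qa; rewrite mem_filter qa mem_primes q_pr n_gt0.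
exists (\prod_(p <- s) p)%N; apply: coprimez_prime_test => // q q_pr qn.
have [qa|qa] := boolP (q %| a)%Z; apply/negP => qat.
  have : (q %| b * (\prod_(p <- s) p)%N)%Z.
    by rewrite -[b * _](addKr a) rpredD ?rpredN.
  rewrite primez_mul // => /orP[qb|].
    have : (q %| gcdz a b)%Z by rewrite dvdz_gcd qa.
    by move: cab => /eqP ->; rewrite dvdz1 => /eqP /= q1; rewrite q1 in q_pr.
  rewrite dvdzE /= => /(prime_dvd_prod_seq q_pr)[p].
  rewrite mem_filter mem_primes => /andP[/negP pa /andP[p_pr _]].
  by rewrite dvdn_prime2 // => /eqP qp; apply: pa; rewrite -qp.
case/negP: (qa); rewrite -[a](addrK (b * (\prod_(p <- s) p)%N)) rpredB //.
apply/dvdz_mull; rewrite dvdzE /= (bigD1_seq q) ?qs //=.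
  by rewrite dvdn_mulr.
by rewrite filter_uniq ?primes_uniq.
Qed.

Lemma gcdz_dvdP (x y : int) (n : nat) :
  (forall e : nat, (e %| n)%N -> (e %| x)%Z = (e %| y)%Z) -> gcdz x n = gcdz y n.
Proof.
move=> H; rewrite /gcdz; congr Posz; apply/eqP.
rewrite eqn_dvd !dvdn_gcd !dvdn_gcdr !andbT.
have := H (gcdn `|x| n) (dvdn_gcdr _ _); rewrite !dvdzE /= dvdn_gcdl => <-.
by have := H (gcdn `|y| n) (dvdn_gcdr _ _); rewrite !dvdzE /= dvdn_gcdl => ->.
Qed.

Lemma dvdz_congr (e : nat) (x y : int) : (e %| x - y)%Z -> (e %| x)%Z = (e %| y)%Z.
Proof.
move=> exy; apply/idP/idP => H.
  by rewrite -(subKr x y) rpredB.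
by rewrite -(subrK y x) rpredD.
Qed.

Lemma gcdz_congr (x y : int) (n : nat) : (n %| x - y)%Z -> gcdz x n = gcdz y n.
Proof.
move=> nxy; apply: gcdz_dvdP => e en; apply: dvdz_congr.
by apply: dvdz_trans nxy; rewrite dvdzE.
Qed.

(** With [x = a * g] and [d = b * g], shifting [a] along [b] to a number prime to [n] changes [x]
    only by a multiple of [d]. *)
Lemma gcdz_lift (x : int) (d n : nat) : (0 < n)%N -> (d %| n)%N ->
  exists2 x' : int, (d %| x' - x)%Z & gcdz x' n = gcdz x d.
Proof.
move=> n_gt0 dn; have d_gt0 := dvdn_gt0 n_gt0 dn.
have [g gE] : exists g : nat, gcdz x d = g by eexists.
have g_gt0 : (0 < g)%N.
  by move: gE; rewrite /gcdz => -[<-]; rewrite gcdn_gt0 d_gt0 orbT.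
have g_neq0 : g%:Z != 0 by rewrite eqz_nat -lt0n.
have /dvdzP[a xE] : (g %| x)%Z by rewrite -gE dvdz_gcdl.
have /dvdzP[b dE] : (g %| d%:Z)%Z by rewrite -gE dvdz_gcdr.
have cab : coprimez a b.
  move: gE; rewrite xE dE -mulz_gcdl /= -[X in _ = X]mul1r.
  by move/(mulIf g_neq0) => h; apply/eqP.
have [t ct] := coprimez_shift n_gt0 cab.
exists ((a + b * t) * g).
  by apply/dvdzP; exists t; rewrite xE dE; ring.
have /dvdnP[c nE] : (g %| n)%N.
  by apply: dvdn_trans dn; rewrite -[(g %| d)%N]/((g%:Z %| d%:Z)%Z) dE dvdz_mull.
rewrite gE {1}nE PoszM -mulz_gcdl /=.
suff -> : gcdz (a + b * t) c = 1 by rewrite mul1r.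
apply/eqP; apply: coprimez_dvdr ct; rewrite nE; exact: dvdn_mulr.
Qed.

Lemma gcdz_eq_unit (x y : int) (n : nat) : (0 < n)%N -> gcdz x n = gcdz y n ->
  exists2 u : int, coprimez u n & (n %| u * x - y)%Z.
Proof.
move=> n_gt0 gxy.
have [g gE] : exists g : nat, gcdz x n = g by eexists.
have g_gt0 : (0 < g)%N.
  by move: gE; rewrite /gcdz => -[<-]; rewrite gcdn_gt0 n_gt0 orbT.
have g_neq0 : g%:Z != 0 by rewrite eqz_nat -lt0n.
have /dvdzP[a xE] : (g %| x)%Z by rewrite -gE dvdz_gcdl.
have /dvdzP[b yE] : (g %| y)%Z by rewrite -gE gxy dvdz_gcdl.
have /dvdzP[m nE] : (g %| n%:Z)%Z by rewrite -gE dvdz_gcdr.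
have cam : coprimez a m.
  move: gE; rewrite xE nE -mulz_gcdl /= -[X in _ = X]mul1r.
  by move/(mulIf g_neq0) => h; apply/eqP.
have cbm : coprimez b m.
  move: gE; rewrite gxy yE nE -mulz_gcdl /= -[X in _ = X]mul1r.
  by move/(mulIf g_neq0) => h; apply/eqP.
case/coprimezP: (cam) => -[s s'] /= sE.
have csm : coprimez (b * s) m.
  rewrite coprimezMl cbm; apply/coprimezP; exists (a, s') => /=.
  by rewrite mulrC.
have [t ct] := coprimez_shift n_gt0 csm.
(* [s] inverts [a] modulo [m = n / g], so [b * s] is right modulo [m]; adding [m * t] makes it a
   unit modulo [n]. *)
exists (b * s + m * t) => //; apply/dvdzP; rewrite xE yE nE.
exists (t * a - b * s').
have -> : (b * s + m * t) * (a * g) - b * g = g%:Z * (b * (s * a - 1) + m * t * a).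
  by ring.
by rewrite -sE; ring.
Qed.

(** * Gcds with [n] and the [p]-part of [n] *)

Section PrimePart.

Variables (p b m : nat).
Hypotheses (p_pr : prime p) (cpm : coprime p m) (m_gt0 : (0 < m)%N).
Local Notation r := (p ^ b)%N.
Local Notation n := (p ^ b * p * m)%N.

Lemma dvdn_ppart_full (d : nat) :
  (d %| n)%N -> ~~ (d %| r * m)%N -> (r * p %| d)%N.
Proof.
move=> dn; apply: contraR => Npd.
have d_gt0 : (0 < d)%N.
  by apply: dvdn_gt0 dn; rewrite !muln_gt0 expn_gt0 prime_gt0 //.
have [d' cpd' dE] := pfactor_coprime p_pr d_gt0.
rewrite -expnSr pfactor_dvdn // -leqNgt in Npd.
rewrite dE mulnC; apply: dvdn_mul; first exact: dvdn_exp2l.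
have : (d' %| p ^ b.+1 * m)%N.
  by rewrite expnSr; apply: dvdn_trans dn; rewrite dE dvdn_mulr.
by rewrite Gauss_dvdr // coprime_sym coprimeXl.
Qed.

Lemma gcdz_mul_ppart (s : int) : ((r * p)%N %| s)%Z -> gcdz (p%:Z * s) n = gcdz s n.
Proof.
move=> rps; apply: gcdz_dvdP => e en; apply/idP/idP => [eps|]; last exact: dvdz_mull.
have e_gt0 : (0 < e)%N.
  by apply: dvdn_gt0 en; rewrite !muln_gt0 expn_gt0 prime_gt0 //.
have [e' cpe' eE] := pfactor_coprime p_pr e_gt0.
have ce : coprime e' (p ^ logn p e) by rewrite coprime_sym coprimeXl.
rewrite eE PoszM Gauss_dvdz; last by rewrite coprimezE.
apply/andP; split.
  have : (e' %| p%:Z * s)%Z.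
    by apply: dvdz_trans eps; rewrite dvdzE /= eE dvdn_mulr.
  by rewrite Gauss_dvdzr // coprimezE /= coprime_sym.
apply: dvdz_trans rps; rewrite dvdzE /= -expnSr dvdn_exp2l //.
rewrite -ltnS ltnNge; apply/negP => lpe.
have : (p ^ b.+2 %| r * p * m)%N.
  by apply: dvdn_trans en; rewrite pfactor_dvdn.
rewrite -expnSr expnSr dvdn_pmul2l ?expn_gt0 ?prime_gt0 // => pm.
by move: cpm; rewrite prime_coprime // pm.
Qed.

(** The two numbers agree modulo [n / p = r * m], and every divisor of [n] not dividing [n / p] is a
    multiple of [r * p], which divides neither of them. *)
Lemma gcdz_add_ppart (s c c' : int) : ((r * p)%N %| s)%Z ->
    ~~ (p %| c)%Z -> ~~ (p %| c')%Z ->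
  gcdz (s + c * (r * m)%N) n = gcdz (s + c' * (r * m)%N) n.
Proof.
move=> rps; have N : forall c : int, ~~ (p %| c)%Z ->
    forall e : nat, (r * p %| e)%N -> (e %| s + c * (r * m)%N)%Z = false.
  move=> {}c pc e rpe; apply: contraNF pc => H.
  have : ((r * p)%N %| c * (r * m)%N)%Z.
    rewrite -[c * _](addKr s) rpredD ?rpredN //.
    by apply: dvdz_trans H; rewrite dvdzE.
  rewrite !PoszM mulrCA dvdz_mul2l; last by rewrite eqz_nat -lt0n expn_gt0 prime_gt0.
  by rewrite Gauss_dvdzl.
move=> pc pc'; apply: gcdz_dvdP => e en.
have [erm|/(dvdn_ppart_full en) rpe] := boolP (e %| r * m)%N; last by rewrite !N.
apply: dvdz_congr; rewrite opprD addrACA subrr add0r -mulrBl.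
exact: dvdz_mull.
Qed.

Lemma gcdz_add_low (t c : int) : ~~ (r %| t)%Z ->
  gcdz (t + c * (r * m)%N) n = gcdz t n.
Proof.
move=> rt; apply: gcdz_dvdP => e en.
have [erm|/(dvdn_ppart_full en) rpe] := boolP (e %| r * m)%N.
  by apply: dvdz_congr; rewrite addrC addKr; apply: dvdz_mull.
have re : (r%:Z %| e%:Z)%Z by apply: dvdn_trans rpe; rewrite dvdn_mulr.
rewrite [RHS](contraNF _ rt); last exact: dvdz_trans.
apply: contraNF rt => /(dvdz_trans re) H.
rewrite -[t](addrK (c * (r * m)%N)) rpredB // dvdz_mull //.
by rewrite dvdzE /= dvdn_mulr.
Qed.

Lemma ppart_shift (t : int) : (r %| t)%Z ->
  exists c : int, ((r * p)%N %| t + c * (r * m)%N)%Z.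
Proof.
case/dvdzP => t' ->; have : coprimez p m by rewrite coprimezE.
case/coprimezP => -[u v] /= uvE; exists (- (t' * v)).
apply/dvdzP; exists (t' * u); rewrite !PoszM.
have -> : t' * r + - (t' * v) * (r%:Z * m) = t' * r%:Z * (1 - v * m) by ring.
by rewrite -uvE; ring.
Qed.

End PrimePart.

Lemma pdvd_decomp (p n : nat) : prime p -> (0 < n)%N -> (p %| n)%N ->
  exists b m : nat, [/\ coprime p m, (0 < m)%N & n = (p ^ b * p * m)%N].
Proof.
move=> p_pr n_gt0 pn; have [m cpm nE] := pfactor_coprime p_pr n_gt0.
exists (logn p n).-1, m; split=> //.
  by move: n_gt0; rewrite nE muln_gt0 => /andP[].
by rewrite {1}nE -expnSr prednK ?logn_gt0 ?mem_primes ?p_pr ?n_gt0 // mulnC.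
Qed.

(** Each of the [k] intervals of length [e] contains one integer congruent to [v]. *)
Lemma sum_dvdz_block (R : nzRingType) (e k : nat) (v : int) : (0 < e)%N ->
  \sum_(u < e * k | (e %| u%:Z - v)%Z) 1 = k%:R :> R.
Proof.
move=> e_gt0; have e_neq0 : e%:Z != 0 by rewrite eqz_nat -lt0n.
rewrite -(big_mkord (fun u => (e %| u%:Z - v)%Z) (fun=> 1)).
elim: k => [|k IHk]; first by rewrite muln0 big_geq.
rewrite mulnS addnC (@big_cat_nat _ _ _ (e * k)) ?leq_addr //= IHk -[in RHS]addn1 natrD.
congr (_ + _); rewrite -{1}[(e * k)%N]add0n big_addn addKn.
have [i iE] : exists i : nat, (v %% e)%Z = i.
  by exists `|(v %% e)%Z|%N; rewrite gez0_abs // modz_ge0.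
have ie : (i < e)%N by rewrite -ltz_nat -iE ltz_pmod.
rewrite big_mkord (bigD1 (Ordinal ie)) /=; last first.
  rewrite PoszD -iE {2}(divz_eq v e) PoszM.
  have -> : (v %% e)%Z + e%:Z * k - ((v %/ e)%Z * e + (v %% e)%Z) =
            (k%:Z - (v %/ e)%Z) * e by ring.
  exact: dvdz_mull.
rewrite big1 ?addr0 // => j /andP[H /eqP ji]; case: ji; apply/val_inj => /=.
apply/eqP; rewrite -(modn_small (ltn_ord j)) -eqz_nat -iE -modz_nat.
rewrite eqz_mod_dvd; have -> : j%:Z - v = ((j + e * k)%N%:Z - v) - k%:Z * e.
  by rewrite PoszD PoszM; ring.
by rewrite rpredB // dvdz_mull.
Qed.

(** * Orbits and blocks of permutation groups of Z/n *)

(* [x] and [y] lie in one orbit of the stabiliser of [0] in [K], acting on Z/n. *)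
Definition orb0 (n : nat) (K : (int -> int) -> Prop) (x y : int) : Prop :=
  exists k, [/\ K k, (n %| k 0)%Z & (n %| k x - y)%Z].

(* A permutation group of Z/n given by representatives [int -> int]; this makes
   passing to a quotient Z/d a mere change of modulus. *)
Record zperm_group (n : nat) (K : (int -> int) -> Prop) : Prop := ZpermGroup {
  zperm_congr : forall k, K k ->
    forall x y, (n %| x - y)%Z -> (n %| k x - k y)%Z;
  zperm_comp : forall k h, K k -> K h -> K (k \o h);
  zperm_trans : forall a : int, K (fun x => x + a);
  zperm_inv : forall k, K k -> exists2 h, K h & forall x, (n %| h (k x) - x)%Z;
  zperm_gcd : forall x y : int, gcdz x n = gcdz y n -> orb0 n K x y
}.

(* The set D(K) of moduli whose residue classes form a block system of [K]. *)
Definition block_modulus (n : nat) (K : (int -> int) -> Prop) (d : nat) : Prop :=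
  (d %| n)%N /\ forall k, K k ->
    forall x y, (d %| x - y)%Z -> (d %| k x - k y)%Z.

Section ZpermGroup.

Variables (n : nat) (K : (int -> int) -> Prop).
Hypotheses (n_gt0 : (0 < n)%N) (KP : zperm_group n K).

Local Notation "x ~ y" := (orb0 n K x y) (at level 70).
Local Notation D := (block_modulus n K).

Lemma orb0_congr (x y : int) : (n %| x - y)%Z -> x ~ y.
Proof.
move=> nxy; exists (fun z => z + 0); split; first exact: (zperm_trans KP).
  by rewrite addr0 dvdz0.
by rewrite addr0.
Qed.

Lemma orb0_refl (x : int) : x ~ x.
Proof. by apply: orb0_congr; rewrite subrr dvdz0. Qed.

Lemma orb0_trans (y x z : int) : x ~ y -> y ~ z -> x ~ z.
Proof.
case=> k [Kk k0 kx] [h [Kh h0 hy]]; exists (h \o k); split=> /=.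
- exact: (zperm_comp KP).
- by rewrite -(subrK (h 0) (h (k 0))) rpredD // (zperm_congr KP) // subr0.
- rewrite -(subrKA (h y)) rpredD //; exact: (zperm_congr KP).
Qed.

Lemma orb0_sym (x y : int) : x ~ y -> y ~ x.
Proof.
case=> k [Kk k0 kx]; have [h Kh hk] := zperm_inv KP Kk.
exists h; split=> //.
  have -> : h 0 = (h (k 0) - 0) - (h (k 0) - h 0) by ring.
  by rewrite rpredB // (zperm_congr KP) // subr0.
have -> : h y - x = (h (k x) - x) - (h (k x) - h y) by ring.
by rewrite rpredB // (zperm_congr KP).
Qed.

(** Conjugation of [k] by translations yields a map that fixes [0] and takes [x - y] to
    [k x - k y]. *)
Lemma orb0_sub (k : int -> int) (x y : int) : K k -> x - y ~ k x - k y.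
Proof.
move=> Kk; exists ((fun z => z + - k y) \o (k \o (fun z => z + y))); split=> /=.
- by do !apply: (zperm_comp KP) => //; apply: (zperm_trans KP).
- by rewrite add0r subrr dvdz0.
- by rewrite subrK subrr dvdz0.
Qed.

Lemma orb0_dvd (d : nat) (x y : int) : D d -> x ~ y -> (d %| x)%Z = (d %| y)%Z.
Proof.
case=> dn dK; suff H u v : u ~ v -> (d %| u)%Z -> (d %| v)%Z.
  by move=> xy; apply/idP/idP; apply: H => //; apply: orb0_sym.
case=> k [Kk k0 ku] du.
have dvd_n z : (n %| z)%Z -> (d %| z)%Z by apply: dvdz_trans; rewrite dvdzE.
have -> : v = (k u - k 0) + k 0 - (k u - v) by ring.
by rewrite rpredB ?(dvd_n _ ku) // rpredD ?(dvd_n _ k0) // dK // subr0.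
Qed.

Lemma orb0_split (x y z : int) : x + y ~ z ->
  exists x' y', [/\ z = x' + y', x ~ x' & y ~ y'].
Proof.
case=> k [Kk k0 kxy].
exists (k x - k 0), (z - (k x - k 0)); split; first by ring.
  by rewrite -{1}[x]subr0; apply: orb0_sub.
apply: (@orb0_trans (k (x + y) - k x)).
  by rewrite -{1}[y](addKr x) addrC; apply: orb0_sub.
apply: orb0_congr.
have -> : k (x + y) - k x - (z - (k x - k 0)) = k (x + y) - z - k 0 by ring.
exact: rpredB.
Qed.

(** A map fixing [0] and moving [x'] to [x] carries [x' + s] to [x] plus an element of the orbit of
    [s]. *)
Lemma orb0_add_subset (x y t : int) : (forall s, y ~ s -> x + s ~ t) ->
  forall x' s, x ~ x' -> y ~ s -> x' + s ~ t.
Proof.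
move=> H x' s /orb0_sym xx' ys.
have [k [Kk k0 kx]] := xx'.
have E : x' + s ~ k (x' + s).
  exists k; split=> //; by rewrite subrr dvdz0.
apply: (orb0_trans E); apply: (@orb0_trans (x + (k (x' + s) - k x'))).
  apply: orb0_congr.
  by have -> : k (x' + s) - (x + (k (x' + s) - k x')) = k x' - x by ring.
apply: H; apply: (orb0_trans ys).
by rewrite -{1}[s](addKr x') addrC; apply: orb0_sub.
Qed.

Lemma block_modulus1 : D 1%N.
Proof. by split=> // k _ x y _; rewrite dvd1z. Qed.

Lemma block_modulus_lcm (d e : nat) : D d -> D e -> D (lcmn d e).
Proof.
move=> [dn dK] [en eK]; split; first by rewrite dvdn_lcm dn.
move=> k Kk x y; rewrite !dvdz_lcm => /andP[dxy exy].
by rewrite dK ?eK.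
Qed.

Lemma block_modulus_gcd (d e : nat) : D d -> D e -> D (gcdn d e).
Proof.
move=> [dn dK] [en eK]; split; first exact: dvdn_trans (dvdn_gcdl _ _) dn.
move=> k Kk x y /dvdzP[q qE].
have [u [v uvE]] := Bezoutz d e.
(* The intermediate point, given by Bezout, is congruent to [x] modulo [d] and to [y] modulo [e]. *)
have -> : k x - k y = (k x - k (y + q * v * e)) + (k (y + q * v * e) - k y) by ring.
apply: rpredD.
  apply: (@dvdz_trans d); first by rewrite dvdzE dvdn_gcdl.
  apply: dK => //; have -> : x - (y + q * v * e) = q * u * d.
    have -> : x = y + (x - y) by ring.
    by rewrite qE -[(gcdn d e)%:Z]/(gcdz d e) -uvE; ring.
  exact: dvdz_mull.
apply: (@dvdz_trans e); first by rewrite dvdzE dvdn_gcdr.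
by apply: eK => //; rewrite addrC addKr dvdz_mull.
Qed.

(** A subgroup of Z containing [n] is [d Z] with [d] its least positive element; as
    [x - y ~ k x - k y], invariance under orbits makes the classes modulo [d] blocks. *)
Lemma block_modulus_subgroup (B : int -> Prop) :
    B n%:Z -> (forall x y, B x -> B y -> B (x - y)) ->
    (forall x y, x ~ y -> B x -> B y) ->
  exists2 d : nat, D d & forall x, B x <-> (d %| x)%Z.
Proof.
move=> Bn BB Borb.
have exd : exists d : nat, (0 < d)%N && boolp.asbool (B d%:Z).
  by exists n; rewrite n_gt0; apply/boolp.asboolP.
case: (ex_minnP exd) => d /andP[d_gt0 /boolp.asboolP Bd] dmin.
have B0 : B 0 by rewrite -(subrr n%:Z); apply: BB.
have BN x : B x -> B (- x) by move=> Bx; rewrite -sub0r; apply: BB.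
have BD x y : B x -> B y -> B (x + y).
  by move=> Bx By; rewrite -[y]opprK; apply: BB => //; apply: BN.
have BMn x (q : nat) : B x -> B (x *+ q).
  by move=> Bx; elim: q => [|q IHq]; rewrite ?mulr0n // mulrS; apply: BD.
have BM x (q : int) : B x -> B (q * x).
  move=> Bx; case: q => q.
    by rewrite -[q%:Z]natz mulr_natl; apply: BMn.
  by rewrite NegzE mulNr -[q.+1%:Z]natz mulr_natl; apply/BN/BMn.
have dB x : B x <-> (d %| x)%Z.
  split=> [Bx|/dvdzP[q ->]]; last exact: BM.
  apply/dvdz_mod0P; apply/eqP; apply: contraT => nz.
  have [i iE] : exists i : nat, (x %% d)%Z = i.
    by exists `|(x %% d)%Z|%N; rewrite gez0_abs // modz_ge0 // eqz_nat -lt0n.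
  have id : (i < d)%N by rewrite -ltz_nat -iE ltz_pmod.
  have : (d <= i)%N.
    apply: dmin; rewrite lt0n -eqz_nat -iE nz /=; apply/boolp.asboolP.
    by rewrite /modz; apply: BB => //; apply: BM.
  by rewrite leqNgt id.
exists d => //; split; first by have /dB := Bn.
move=> k Kk x y /dB Bxy; apply/dB; apply: Borb Bxy; exact: orb0_sub.
Qed.

Inductive orb0_span (x : int) : int -> Prop :=
  | Orb0Span0 : orb0_span x 0
  | Orb0SpanD a t : orb0_span x a -> x ~ t -> orb0_span x (a + t)
  | Orb0SpanB a t : orb0_span x a -> x ~ t -> orb0_span x (a - t).

(** The subgroup generated by [n] and the orbit of [x] is invariant under orbits, hence equals [d Z]
    for a block modulus [d]; a common divisor [c] of the generators divides [d]. *)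
Lemma orb0_span_block (x : int) (c : nat) :
    (forall t, x ~ t -> (c %| t)%Z) -> (c %| n)%N ->
  exists d : nat, [/\ D d, (c %| d)%N & (d %| x)%Z].
Proof.
move=> Hc cn.
pose B z := exists2 a, orb0_span x a & (n %| z - a)%Z.
have spanB a b : orb0_span x a -> orb0_span x b -> orb0_span x (a - b).
  move=> Sa; elim=> [|b' t Sb IH xt|b' t Sb IH xt].
  - by rewrite subr0.
  - by rewrite opprD addrA; apply: Orb0SpanB.
  - by rewrite opprB addrCA addrC; apply: Orb0SpanD.
have span_k k a : K k -> orb0_span x a -> orb0_span x (k a - k 0).
  move=> Kk; elim=> [|b t Sb IH xt|b t Sb IH xt].
  - by rewrite subrr; apply: Orb0Span0.
  - have -> : k (b + t) - k 0 = (k b - k 0) + (k (b + t) - k b) by ring.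
    apply: Orb0SpanD => //; apply: (orb0_trans xt).
    by rewrite -{1}[t](addKr b) addrC; apply: orb0_sub.
  - have -> : k (b - t) - k 0 = (k b - k 0) - (k b - k (b - t)) by ring.
    apply: Orb0SpanB => //; apply: (orb0_trans xt).
    by rewrite -{1}[t](subKr b); apply: orb0_sub.
have [] := @block_modulus_subgroup B.
- by exists 0; [apply: Orb0Span0 | rewrite subr0].
- move=> u v [a Sa ua] [b Sb vb]; exists (a - b); first exact: spanB.
  by have -> : u - v - (a - b) = (u - a) - (v - b) by [ring]; rewrite rpredB.
- move=> u v [k [Kk k0 ku]] [a Sa ua]; exists (k a - k 0); first exact: span_k.
  have -> : v - (k a - k 0) = (k u - k a) - (k u - v) + k 0 by ring.
  by rewrite rpredD // rpredB // (zperm_congr KP).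
move=> d Dd BdE; exists d; split=> //; last first.
  apply/BdE; exists (0 + x); last by rewrite add0r subrr dvdz0.
  by apply: Orb0SpanD (orb0_refl x); apply: Orb0Span0.
have /BdE[a Sa da] := dvdzz d.
have ca : (c %| a)%Z.
  elim: Sa => [|b t _ cb /Hc ct|b t _ cb /Hc ct]; first exact: dvdz0.
    exact: rpredD.
  exact: rpredB.
have: (c %| d%:Z)%Z.
  rewrite -(subrK a d%:Z) rpredD //; apply: dvdz_trans da; by rewrite dvdzE.
by rewrite dvdzE.
Qed.

Lemma max_block_modulus (x : int) :
  exists2 e : nat, D e & forall d : nat, D d -> (d %| x)%Z = (d %| e)%N.
Proof.
pose P (e : nat) := boolp.asbool (D e /\ (e %| x)%Z).
have exP : exists e, P e.
  by exists 1%N; apply/boolp.asboolP; split; [apply: block_modulus1 | rewrite dvd1z].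
have ubP e : P e -> (e <= n)%N.
  by case/boolp.asboolP => -[en _] _; apply: dvdn_leq.
case: (ex_maxnP exP ubP) => e /boolp.asboolP[De ex] emax.
exists e => // d Dd; apply/idP/idP => [dx|de]; last first.
  by apply: dvdz_trans ex; rewrite dvdzE.
have: (lcmn d e <= e)%N.
  by apply/emax/boolp.asboolP; split; [exact: block_modulus_lcm | rewrite dvdz_lcm dx].
have e_gt0 : (0 < e)%N by case: De => en _; apply: dvdn_gt0 en.
move=> le; have /eqP <- : lcmn d e == e; last exact: dvdn_lcml.
rewrite eqn_leq le dvdn_leq ?dvdn_lcmr // lcmn_gt0 e_gt0 andbT.
by case: Dd => dn _; apply: dvdn_gt0 dn.
Qed.

(** The periods of the orbit of [x], that is its radical, form a subgroup invariant under orbits by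
    [orb0_add_subset]; the period [g] keeps its modulus [d] below [n]. *)
Lemma radical_block (x g : int) :
    (forall t, x ~ t -> x ~ g + t) -> ~~ (n %| g)%Z ->
  exists d : nat, [/\ D d, (d < n)%N & forall t q : int, x ~ t -> x ~ t + q * d%:Z].
Proof.
move=> Hg ng.
pose B (b : int) := forall t, x ~ t -> x ~ b + t.
have BD u v : B u -> B v -> B (u + v).
  by move=> Bu Bv t xt; rewrite -addrA; apply/Bu/Bv.
have Bcong u v : (n %| u - v)%Z -> B u -> B v.
  move=> nuv Bu t xt; apply: (orb0_trans (Bu t xt)); apply: orb0_congr.
  by have -> : u + t - (v + t) = u - v by ring.
have Bn : B n%:Z.
  move=> t xt; apply: (orb0_trans xt); apply: orb0_congr.
  by have -> : t - (n%:Z + t) = - n%:Z by [ring]; rewrite rpredN.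
have B0 : B 0 by apply: Bcong Bn; rewrite subr0.
have BN u : B u -> B (- u).
  move=> Bu; have Bm (q : nat) : B (u *+ q).
    by elim: q => [|q IHq]; rewrite ?mulr0n // mulrS; apply: BD.
  apply: Bcong (Bm n.-1); rewrite opprK -mulrSr prednK // -mulr_natl natz.
  exact: dvdz_mulr.
have [] := @block_modulus_subgroup B => //.
- by move=> u v Bu Bv; apply: BD => //; apply: BN.
- move=> u v uv Bu t xt; apply: orb0_sym.
  apply: (orb0_add_subset (x := u) (y := x)) => //.
  by move=> s xs; apply/orb0_sym/Bu.
move=> d [dn dK] BdE; exists d; split=> //.
  rewrite ltn_neqAle dvdn_leq // andbT; apply: contraNneq ng => <-.
  exact/BdE.
move=> t q xt; rewrite addrC.
by have /BdE : (d %| q * d%:Z)%Z by [apply: dvdz_mull]; apply.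
Qed.

End ZpermGroup.

(** The condition on gcds descends by [gcdz_lift]: residues modulo [d] with equal gcd lift to
    residues modulo [n] with equal gcd. *)
Lemma zperm_group_quotient (n d : nat) K : (0 < n)%N ->
  zperm_group n K -> block_modulus n K d -> zperm_group d K.
Proof.
move=> n_gt0 KP [dn dK]; have dvd_n z : (n %| z)%Z -> (d %| z)%Z.
  by apply: dvdz_trans; rewrite dvdzE.
split=> // [k h|||x y gxy]; [exact: (zperm_comp KP)|exact: (zperm_trans KP)| |].
  move=> k /(zperm_inv KP)[h Kh hk]; exists h => // x; exact: dvd_n.
have [x' xx' x'E] := gcdz_lift x n_gt0 dn.
have [y' yy' y'E] := gcdz_lift y n_gt0 dn.
have [k [Kk k0 kx]] : orb0 n K x' y'.
  by apply: (zperm_gcd KP); rewrite x'E y'E.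
exists k; split=> //; first exact: dvd_n.
have -> : k x - y = - (k x' - k x) + (k x' - y') + (y' - y) by ring.
by rewrite rpredD // rpredD ?(dvd_n _ kx) // rpredN dK.
Qed.

(** * Restriction to the subgroup [e Z/n] *)

Definition zperm_restrict (e : nat) (K : (int -> int) -> Prop) (h : int -> int) :=
  exists2 k, K k & forall x, k (e%:Z * x) = e%:Z * h x.

Section Restrict.

Variables (n e : nat) (K : (int -> int) -> Prop).
Hypotheses (n_gt0 : (0 < n)%N) (KP : zperm_group n K) (De : block_modulus n K e).

Let m := (n %/ e)%N.
Let nE : n%:Z = e%:Z * m%:Z.
Proof. by case: De => en _; rewrite -PoszM mulnC divnK. Qed.
Let e_gt0 : (0 < e)%N. Proof. by case: De => en _; apply: dvdn_gt0 en. Qed.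
Let e_neq0 : e%:Z != 0. Proof. by rewrite eqz_nat -lt0n. Qed.

Let dvd_e (z : int) : (n %| z)%Z -> (e %| z)%Z.
Proof. by case: De => en _; apply: dvdz_trans; rewrite dvdzE. Qed.

Let restr k : K k -> (e %| k 0)%Z ->
  exists2 h, zperm_restrict e K h & forall x, k (e%:Z * x) = e%:Z * h x.
Proof.
move=> Kk k0.
have kE x : k (e%:Z * x) = e%:Z * (k (e%:Z * x)%R %/ e)%Z.
  rewrite [RHS]mulrC divzK // -(subrK (k 0) (k _)) rpredD //.
  by case: De => _ -> //; rewrite subr0 dvdz_mulr.
by exists (fun x => (k (e%:Z * x)%R %/ e)%Z) => //; exists k.
Qed.

Lemma orb0_restrict (x y : int) :
  orb0 m (zperm_restrict e K) x y <-> orb0 n K (e%:Z * x) (e%:Z * y).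
Proof.
split=> [[h [[k Kk kh] h0 hx]]|[k [Kk k0 kx]]].
  exists k; split=> //.
    have -> : k 0 = e%:Z * h 0 by rewrite -kh mulr0.
    by rewrite nE dvdz_mul2l.
  by rewrite kh -mulrBr nE dvdz_mul2l.
have [h Rh hE] := restr Kk (dvd_e k0).
exists h; split=> //.
  have k0E : k 0 = e%:Z * h 0 by rewrite -hE mulr0.
  by move: k0; rewrite k0E nE dvdz_mul2l.
by move: kx; rewrite hE -mulrBr nE dvdz_mul2l.
Qed.

Lemma zperm_group_restrict : zperm_group m (zperm_restrict e K).
Proof.
split.
- move=> h [k Kk kh] x y mxy; rewrite -(dvdz_mul2l e_neq0) -nE mulrBr -!kh.
  by apply: (zperm_congr KP) => //; rewrite -mulrBr nE dvdz_mul2l.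
- move=> h1 h2 [k1 Kk1 kh1] [k2 Kk2 kh2]; exists (k1 \o k2).
    exact: (zperm_comp KP).
  by move=> x /=; rewrite kh2 kh1.
- move=> a; exists (fun x => x + e%:Z * a); first exact: (zperm_trans KP).
  by move=> x; rewrite mulrDr.
- move=> h [k Kk kh]; have [k' Kk' k'k] := zperm_inv KP Kk.
  have k'0 : (e %| k' 0)%Z.
    have ek0 : (e %| k 0)%Z by have -> : k 0 = e%:Z * h 0 by [rewrite -kh mulr0]; rewrite dvdz_mulr.
    have -> : k' 0 = (k' (k 0) - 0) - (k' (k 0) - k' 0) by ring.
    by rewrite rpredB ?(dvd_e (k'k 0)) //; case: De => _ -> //; rewrite subr0.
  have [h' Rh' h'E] := restr Kk' k'0.
  exists h' => // x; rewrite -(dvdz_mul2l e_neq0) -nE mulrBr -h'E -kh.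
  exact: k'k.
- move=> x y gxy; apply/orb0_restrict/(zperm_gcd KP).
  by rewrite nE -!mulz_gcdr gxy.
Qed.

Lemma block_modulus_restrict (d : nat) :
  block_modulus m (zperm_restrict e K) d -> block_modulus n K (e * d).
Proof.
case=> dm dK; split.
  have : ((e * d)%N%:Z %| n%:Z)%Z by rewrite nE PoszM dvdz_mul2l.
  by rewrite dvdzE.
(* [k1] fixes [0], hence restricts to [e Z], and it sends [x - y] to [k x - k y]. *)
move=> k Kk x y /dvdzP[q qE]; pose k1 := (fun z => z - k y) \o (k \o (fun z => z + y)).
have Kk1 : K k1 by do !apply: (zperm_comp KP) => //; apply: (zperm_trans KP).
have k10 : k1 0 = 0 by rewrite /k1 /= add0r subrr.
have [|h Rh hE] := restr Kk1; first by rewrite k10 dvdz0.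
have -> : k x - k y = e%:Z * (h (q * d) - h 0).
  rewrite mulrBr -!hE mulr0 k10 subr0 /k1 /=; congr (k _ - _).
  by rewrite -(subrK y x) qE PoszM; ring.
by rewrite PoszM dvdz_mul2l // dK // subr0 dvdz_mull.
Qed.

End Restrict.

(** * Schur's power trick *)

Section Residue.

Variable m : nat.
Local Notation n := m.+1.

Definition zres (z : int) : 'I_n := inord `|(z %% n%:Z)%Z|.

Lemma zresP (z : int) : (n %| (zres z : nat)%:Z - z)%Z.
Proof.
rewrite /zres inordK; last first.
  by rewrite -ltz_nat gez0_abs ?modz_ge0 // ltz_pmod.
rewrite gez0_abs ?modz_ge0 // {2}(divz_eq z n) opprD addrCA subrr addr0.
by rewrite rpredN dvdz_mull.
Qed.

Lemma zres_eq (i : 'I_n) (z : int) : (n %| (i : nat)%:Z - z)%Z = (i == zres z).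
Proof.
apply/idP/eqP => [H|->]; last exact: zresP.
have : (n %| (i : nat)%:Z - (zres z : nat)%:Z)%Z.
  by rewrite -(subrKA z) rpredD // -opprB rpredN zresP.
rewrite -eqz_mod_dvd !modz_nat eqz_nat !modn_small // => /eqP H'.
exact: val_inj.
Qed.

Lemma eq_zres (y z : int) : (n %| y - z)%Z = (zres y == zres z).
Proof.
rewrite -zres_eq; apply/idP/idP => H.
  by rewrite -(subrKA y) rpredD // zresP.
by rewrite -(subrKA (zres y : nat)%:Z) rpredD // -opprB rpredN zresP.
Qed.

Lemma zres_nat (i : 'I_n) : zres (i : nat)%:Z = i.
Proof. by apply/eqP; rewrite eq_sym -zres_eq subrr dvdz0. Qed.

End Residue.

Lemma pFrobenius_sum_comm (A : nzRingType) (p : nat) (I : Type) (s : seq I)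
    (P : pred I) (F : I -> A) : p \in [pchar A] ->
  (forall i j, GRing.comm (F i) (F j)) ->
  (\sum_(i <- s | P i) F i) ^+ p = \sum_(i <- s | P i) F i ^+ p.
Proof.
move=> charA cF; have p_gt0 : (0 < p)%N by case/andP: charA => /prime_gt0.
elim: s => [|i s IHs]; first by rewrite !big_nil expr0n gtn_eqF.
rewrite !big_cons; case: (P i) => //; rewrite -IHs.
rewrite -!(pFrobenius_autE charA) pFrobenius_autD_comm //.
by apply: commr_sum => j _.
Qed.

Section PowerCount.

Variables (m : nat) (K : (int -> int) -> Prop).
Local Notation n := m.+1.
Hypothesis KP : zperm_group n K.
Variables (p : nat) (T : int -> bool).
Hypotheses (p_pr : prime p) (TP : forall x y, orb0 n K x y -> T x = T y).

(** Modulo [p] this is the coefficient of [z] in the [p]-th power of the formal sum of [T] in the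
    group algebra of Z/n, realised below by circulant matrices. *)
Definition power_count (z : int) : 'F_p :=
  \sum_(u < n | T (u : nat)%:Z && (n %| p%:Z * (u : nat)%:Z - z)%Z) 1.

Let shift_mx (t : int) : 'M['F_p]_n :=
  \matrix_(i, j) ((n %| (j : nat)%:Z - (i : nat)%:Z - t)%Z)%:R.

Let conv_mx : 'M['F_p]_n := \matrix_(i, j) (T ((j : nat)%:Z - (i : nat)%:Z))%:R.

Let shift_mxM (s t : int) : shift_mx s * shift_mx t = shift_mx (s + t).
Proof.
apply/matrixP => i j; rewrite !mxE.
rewrite (bigD1 (zres m ((i : nat)%:Z + s))) //= !mxE.
rewrite big1 ?addr0 => [|k Hk]; last first.
  by rewrite !mxE -addrA -opprD zres_eq (negPf Hk) mul0r.
rewrite -addrA -opprD zresP mul1r; congr (_%:R); congr (nat_of_bool _).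
set k := zres _ _; have Hk : (n %| (k : nat)%:Z - ((i : nat)%:Z + s))%Z by apply: zresP.
have -> : (j : nat)%:Z - (k : nat)%:Z - t = ((j : nat)%:Z - (i : nat)%:Z - (s + t))
   - ((k : nat)%:Z - ((i : nat)%:Z + s)) by ring.
apply/idP/idP => H; last by rewrite rpredB.
by rewrite -(subrK ((k : nat)%:Z - ((i : nat)%:Z + s)) (_ - (s + t))) rpredD.
Qed.

Let shift_mxX (t : int) (q : nat) : shift_mx t ^+ q = shift_mx (q%:Z * t).
Proof.
elim: q => [|q IHq].
  rewrite expr0 mul0r; apply/matrixP => i j; rewrite !mxE subr0.
  by rewrite zres_eq zres_nat eq_sym.
by rewrite exprS IHq shift_mxM intS mulrDl mul1r.
Qed.

Let conv_mxE : conv_mx = \sum_(t < n | T (t : nat)%:Z) shift_mx (t : nat)%:Z.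
Proof.
apply/matrixP => i j; rewrite !mxE summxE big_mkcond /=.
pose t := zres m ((j : nat)%:Z - (i : nat)%:Z).
rewrite (bigD1 t) //= big1 ?addr0 => [|u Hu]; last first.
  case: ifP => // _; rewrite mxE -opprB dvdzE abszN -dvdzE zres_eq.
  by rewrite (negPf Hu).
have -> : T ((j : nat)%:Z - (i : nat)%:Z) = T (t : nat)%:Z.
  apply: TP; apply: (orb0_congr KP); rewrite -opprB rpredN; exact: zresP.
by case: ifP => // _; rewrite mxE -opprB dvdzE abszN -dvdzE zresP.
Qed.

Let power_countE (x : int) : power_count x = (conv_mx ^+ p) (zres m 0) (zres m x).
Proof.
have charM : p \in [pchar 'M['F_p]_n].
  rewrite inE p_pr /= -(rmorph_nat (@scalar_mx 'F_p n)).
  by rewrite (pcharf0 (pchar_Fp p_pr)) rmorph0.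
rewrite conv_mxE pFrobenius_sum_comm //; last first.
  by move=> i j; rewrite /GRing.comm !shift_mxM addrC.
rewrite summxE /power_count big_mkcondr /=; apply: eq_bigr => t _.
rewrite shift_mxX mxE.
have -> : (n %| (zres m x : nat)%:Z - (zres m 0 : nat)%:Z - p%:Z * (t : nat)%:Z)%Z =
          (n %| p%:Z * (t : nat)%:Z - x)%Z.
  set a := (zres m x : nat)%:Z; set b := (zres m 0 : nat)%:Z.
  have Hb : (n %| b)%Z by rewrite -[b]subr0; apply: zresP.
  have Ha : (n %| a - x)%Z by apply: zresP.
  have HE : a - b - p%:Z * (t : nat)%:Z = (a - x - b) - (p%:Z * (t : nat)%:Z - x).
    by ring.
  have Hab : (n %| a - x - b)%Z by rewrite rpredB.
  rewrite HE; apply/idP/idP => H; last by rewrite rpredB.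
  by rewrite -(subKr (a - x - b) (_ - x)) rpredB.
by case: ifP.
Qed.

(* Modulo [p], the [p]-th convolution power of the indicator of [T] is supported
   on the multiples [p * t], because of the Frobenius endomorphism. *)
Lemma power_count_orb0 (x y : int) : orb0 n K x y -> power_count x = power_count y.
Proof.
case=> k [Kk k0 kx]; rewrite !power_countE.
pose s (i : 'I_n) := zres m (k (i : nat)%:Z).
have s_inj : injective s.
  move=> i j /eqP; rewrite -eq_zres => kij; have [h Kh hk] := zperm_inv KP Kk.
  apply/eqP; rewrite -[j]zres_nat -zres_eq.
  have -> : (i : nat)%:Z - (j : nat)%:Z = (h (k (i : nat)%:Z) - h (k (j : nat)%:Z))
     - (h (k (i : nat)%:Z) - (i : nat)%:Z) + (h (k (j : nat)%:Z) - (j : nat)%:Z).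
    by ring.
  by rewrite rpredD // rpredB // (zperm_congr KP).
(* [T] is a union of orbits of the stabiliser of [0], so [conv_mx] and its powers are invariant
   under [s], which fixes [0] and maps [x] to [y]. *)
have conv_s i j : conv_mx (s i) (s j) = conv_mx i j.
  rewrite !mxE; congr (_%:R); congr (nat_of_bool _); apply/esym/TP.
  apply: (orb0_trans KP (orb0_sub KP _ _ Kk)); apply: (orb0_congr KP).
  set a := k _; set b := k _.
  have -> : a - b - ((s j : nat)%:Z - (s i : nat)%:Z) =
    ((s i : nat)%:Z - b) - ((s j : nat)%:Z - a) by ring.
  by rewrite rpredB // zresP.
have convX q i j : (conv_mx ^+ q) (s i) (s j) = (conv_mx ^+ q) i j.
  elim: q i j => [|q IHq] i j; first by rewrite !expr0 !mxE (inj_eq s_inj).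
  rewrite !exprS !mxE (reindex_inj s_inj) /=; apply: eq_bigr => l _.
  by rewrite conv_s IHq.
have s0 : s (zres m 0) = zres m 0.
  apply/eqP; rewrite /s -eq_zres subr0 -(subrK (k 0) (k _)) rpredD //.
  by rewrite (zperm_congr KP) // zresP.
have sx : s (zres m x) = zres m y.
  apply/eqP; rewrite /s -eq_zres -(subrKA (k x)) rpredD //.
  by rewrite (zperm_congr KP) // zresP.
by rewrite -{2}s0 -sx convX.
Qed.

End PowerCount.

(** * Splitting an orbit at a prime [p] *)

Section OrbitDecomposition.

Variables (n : nat) (K : (int -> int) -> Prop).
Hypotheses (n_gt0 : (0 < n)%N) (KP : zperm_group n K).
Variables (p b m : nat).
Hypotheses (p_pr : prime p) (cpm : coprime p m) (m_gt0 : (0 < m)%N).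
Hypothesis nE : n = (p ^ b * p * m)%N.
Let r := (p ^ b)%N.
Let g := (r * m)%N.

Local Notation "x ~ y" := (orb0 n K x y) (at level 70).
Local Notation D := (block_modulus n K).

Variable x : int.
Hypothesis x_prim : forall d : nat, D d -> (d %| x)%Z -> d = 1%N.
Hypothesis x_rad : forall h : int, (forall t, x ~ t -> x ~ h + t) -> (n %| h)%Z.

Let T (z : int) : bool := boolp.asbool (x ~ z).

Let TP (y z : int) : y ~ z -> T y = T z.
Proof.
move=> yz; apply/boolp.asboolP/boolp.asboolP => H.
  exact: (orb0_trans KP H).
exact: (orb0_trans KP H (orb0_sym KP yz)).
Qed.

Let r_gt0 : (0 < r)%N. Proof. by rewrite expn_gt0 prime_gt0. Qed.
Let g_gt0 : (0 < g)%N. Proof. by rewrite muln_gt0 r_gt0. Qed.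
Let nE' : n = (g * p)%N. Proof. by rewrite nE mulnAC. Qed.

Let dvd_ng (y : int) : (n %| p%:Z * y)%Z = (g %| y)%Z.
Proof.
by rewrite nE' PoszM [g%:Z * _]mulrC dvdz_mul2l // eqz_nat -lt0n prime_gt0.
Qed.

Let dvd_nc (c : int) : (n %| c * g%:Z)%Z = (p %| c)%Z.
Proof. by rewrite nE' PoszM [g%:Z * _]mulrC dvdz_mul2r // eqz_nat -lt0n. Qed.

(** Unless [r] divides [t], adding multiples of [g = n / p] preserves the gcd with [n], hence the
    orbit. *)
Let T_low (t c : int) : T t -> ~~ T (t + c * g%:Z) -> (r %| t)%Z.
Proof.
move=> Tt; apply: contraR => rt; rewrite -(@TP t) //.
by apply: (zperm_gcd KP); rewrite nE gcdz_add_low.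
Qed.

Let T_ppart (s c : int) : ((r * p)%N %| s)%Z -> ~~ (p %| c)%Z ->
  T (s + c * g%:Z) = T (s + g%:Z).
Proof.
move=> rps pc; rewrite -[g%:Z in RHS]mul1r; apply/TP/(zperm_gcd KP).
rewrite nE (gcdz_add_ppart p_pr cpm m_gt0 rps pc (c' := 1)) //.
by rewrite dvdz1 /= gtn_eqF // prime_gt1.
Qed.

Let n_succ : exists k, n = k.+1.
Proof. by exists n.-1; rewrite prednK. Qed.

(* A coset of the subgroup of order [p] meets the orbit in none, all, all but one
   or exactly one of its points; only the last two cases count modulo [p]. *)
Let power_trick : exists N : int -> 'F_p,
  [/\ forall y z, y ~ z -> N y = N z,
      forall z, N z != 0 ->
        exists u, [/\ x ~ u, (n %| p%:Z * u - z)%Z & (r %| u)%Z]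
    & exists2 v, ((r * p)%N %| v)%Z & N (p%:Z * v) != 0].
Proof.
have [k nk] := n_succ.
have KP' : zperm_group k.+1 K by rewrite -nk.
have TP' y z : orb0 k.+1 K y z -> T y = T z by rewrite -nk; apply: TP.
exists (@power_count k p T); split.
- by rewrite nk => y z; apply: power_count_orb0.
- move=> z; rewrite /power_count => Nz.
  have [[u Tu nu]|Nu] := boolp.EM (exists2 u : int, T u & (n %| p%:Z * u - z)%Z);
    last first.
    case/eqP: Nz; rewrite big_pred0 // => u; apply/negP => /andP[Tu nu].
    by apply: Nu; exists (u : nat)%:Z; rewrite // nk.
  exists u; split=> //; first exact/boolp.asboolP.
  (* If the whole coset of [u] modulo [g] lies in [T], it contributes [p], which is [0] in ['F_p];
     otherwise [T_low] applies. *)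
  have [[c Tc]|Nc] := boolp.EM (exists c : int, ~~ T (u + c * g%:Z)).
    exact: T_low Tu Tc.
  case/eqP: Nz; rewrite (eq_bigl (fun w : 'I_k.+1 => (g %| (w : nat)%:Z - u)%Z)).
    move: (sum_dvdz_block 'F_p p u g_gt0); rewrite -nE' nk => ->.
    exact: (pcharf0 (pchar_Fp p_pr)).
  case=> w /= _; rewrite -nk -dvd_ng.
  have -> : (n %| p%:Z * w%:Z - z)%Z = (n %| p%:Z * (w%:Z - u))%Z.
    have -> : p%:Z * w%:Z - z = p%:Z * (w%:Z - u) + (p%:Z * u - z) by ring.
    by rewrite rpredDr.
  rewrite dvd_ng; apply: andb_idl => /dvdzP[c wE].
  have -> : w%:Z = u + c * g%:Z by rewrite -wE; ring.
  by apply: contraT => H; case: Nc; exists c.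
(* As the radical is trivial, [g] is not a period of the orbit. *)
have [t xt xgt] : exists2 t, x ~ t & ~ x ~ g%:Z + t.
  apply: boolp.contrapT => H.
  have : (n %| g%:Z)%Z.
    by apply: x_rad => t xt; apply: boolp.contrapT => H'; apply: H; exists t.
  by rewrite -[g%:Z]mul1r dvd_nc dvdz1 /= gtn_eqF // prime_gt1.
have Tt : T t by apply/boolp.asboolP.
have Tgt : ~~ T (t + 1 * g%:Z) by rewrite mul1r addrC; apply/boolp.asboolP.
have [c0 rpv] := ppart_shift cpm (T_low Tt Tgt).
(* [v] is the multiple of [r * p] in the coset of [t]; it will be the point that [T] separates from
   all others of the coset. *)
set v := t + _ in rpv; exists v => //.
have TvE c : T (v + c * g%:Z) = if (p %| c)%Z then T v else T (v + g%:Z).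
  case: ifP => [pc|/negbT]; last exact: T_ppart.
  by apply: TP; apply: (orb0_congr KP); rewrite addrAC subrr add0r dvd_nc.
have Tneq : T v != T (v + g%:Z).
  apply/negP => /eqP Tv; have TvE' c : T (v + c * g%:Z) = T v.
    by rewrite TvE -Tv if_same.
  have := TvE' (- c0); have := TvE' (1 - c0).
  have -> : v + (1 - c0) * g%:Z = t + 1 * g%:Z by rewrite /v -/g; ring.
  have -> : v + - c0 * g%:Z = t by rewrite /v -/g; ring.
  by rewrite (negPf Tgt) Tt => <-.
pose beta := (T (v + g%:Z))%:R : 'F_p.
rewrite /power_count big_mkcondl /=.
rewrite (eq_bigl (fun w : 'I_k.+1 => (g %| (w : nat)%:Z - v)%Z)); last first.
  by case=> w /= _; rewrite -nk -mulrBr dvd_ng.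
(* Each of the [p] points of the coset counts [beta], with a correction at [v]; modulo [p] only the
   correction remains, and it is nonzero. *)
have -> : \sum_(w < k.+1 | (g %| (w : nat)%:Z - v)%Z)
    (if T (w : nat)%:Z then 1 else 0) = beta * p%:R + ((T v)%:R - beta) :> 'F_p.
  have sumbeta : \sum_(w < k.+1 | (g %| (w : nat)%:Z - v)%Z) beta = beta * p%:R.
    rewrite -{1}[beta]mulr1 -mulr_sumr; congr (_ * _).
    by move: (sum_dvdz_block 'F_p p v g_gt0); rewrite -nE' nk.
  have Hv : (g %| (zres k v : nat)%:Z - v)%Z.
    by apply: dvdz_trans (zresP k v); rewrite -nk nE' dvdzE /= dvdn_mulr.
  rewrite -sumbeta (bigD1 (zres k v)) //= [X in _ = X + _](bigD1 (zres k v)) //=.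
  rewrite (eq_bigr (fun=> beta)); last first.
    move=> w /andP[/dvdzP[c wE]]; rewrite -zres_eq wE => nc.
    have pc : ~~ (p %| c)%Z by rewrite -dvd_nc nk.
    have -> : (w : nat)%:Z = v + c * g%:Z by rewrite -wE; ring.
    by rewrite TvE (negPf pc) /beta; case: (T _).
  have -> : T (zres k v : nat)%:Z = T v.
    by apply: TP; apply: (orb0_congr KP); rewrite nk zresP.
  rewrite addrAC [beta + _]addrC subrK; congr (_ + _).
  by case: (T v).
rewrite (pcharf0 (pchar_Fp p_pr)) mulr0 add0r /beta.
by move: Tneq; case: (T v); case: (T _); rewrite ?subr0 ?sub0r ?oppr_eq0 ?oner_eq0.
Qed.

(** For [s] in the orbit of [v], [p * s ~ s] gives [N (p * s) != 0], hence some [s + c * g] in [T].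
    Here [p] does not divide [c], since [v] is outside [T], so [T_ppart] yields [s + g] in [T]. *)
Lemma orb0_decompose : exists (v : int) (f : nat),
  [/\ D f, (p ^ b * p %| f)%N, (f %| v)%Z &
      forall y s, (p ^ b * m)%N%:Z ~ y -> v ~ s -> y + s ~ x].
Proof.
have [N [NP suppN [v rpv Npv]]] := power_trick.
have n_rp : (r * p %| n)%N by rewrite nE dvdn_mulr.
have supp_dvd z : N z != 0 -> ((r * p)%N %| z)%Z.
  case/suppN => u [xu nu ru].
  rewrite -(subKr (p%:Z * u) z) rpredB //.
    by rewrite mulnC PoszM dvdz_mul.
  by apply: dvdz_trans nu; rewrite dvdzE.
have ps_s s : ((r * p)%N %| s)%Z -> p%:Z * s ~ s.
  by move=> rps; apply: (zperm_gcd KP); rewrite nE gcdz_mul_ppart.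
have Nv : N v != 0 by rewrite -(NP _ _ (ps_s v rpv)).
have Ns s : v ~ s -> N s != 0 by move=> vs; rewrite -(NP _ _ vs).
have rps s : v ~ s -> ((r * p)%N %| s)%Z by move=> vs; apply/supp_dvd/Ns.
(* Otherwise [r * p] would divide the whole orbit of [x], and so some block modulus dividing [x],
   against [x_prim]. *)
have Tv : ~ x ~ v.
  move=> xv.
  have [|//|d [Dd rpd dx]] := orb0_span_block n_gt0 KP (x := x) (c := (r * p)%N).
    by move=> t xt; apply: rps; apply: (orb0_trans KP (orb0_sym KP xv)).
  have d1 := x_prim Dd dx; move: rpd; rewrite d1 dvdn1 muln_eq1 => /andP[_ /eqP p1].
  by move: p_pr; rewrite p1.
have [//|//|f [Df rpf fv]] := orb0_span_block n_gt0 KP (x := v) (c := (r * p)%N).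
exists v, f; split=> //.
apply: (orb0_add_subset KP) => s vs.
have /suppN[u [xu nu _]] : N (p%:Z * s) != 0.
  by rewrite (NP _ _ (ps_s s (rps s vs))) Ns.
move: nu; rewrite -mulrBr dvd_ng => /dvdzP[c uE].
have uE' : u = s + c * g%:Z by rewrite -uE; ring.
have pc : ~~ (p %| c)%Z.
  apply/negP => pc; apply: Tv; apply: (orb0_trans KP xu).
  apply: (orb0_trans KP _ (orb0_sym KP vs)); apply: (orb0_congr KP).
  by rewrite uE dvd_nc.
have := T_ppart (rps s vs) pc; rewrite -uE' addrC => TE.
apply: (orb0_sym KP); apply/boolp.asboolP; rewrite -[boolp.asbool _]/(T _) -TE.
exact/boolp.asboolP.
Qed.

End OrbitDecomposition.

(** * Orbits are determined by blocks *)

(** Block moduli [d] of the restriction give block moduli [e * d] of [K], so the hypothesis on [x]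
    and [y] passes to their quotients by [e]. *)
Lemma orb0_rescale (n : nat) (K : (int -> int) -> Prop) (e : nat) :
    (0 < n)%N -> zperm_group n K -> block_modulus n K e ->
    (forall x y, (forall d, block_modulus (n %/ e) (zperm_restrict e K) d ->
        (d %| x)%Z = (d %| y)%Z) -> orb0 (n %/ e) (zperm_restrict e K) x y) ->
  forall x y, (e %| x)%Z -> (e %| y)%Z ->
    (forall d, block_modulus n K d -> (d %| x)%Z = (d %| y)%Z) -> orb0 n K x y.
Proof.
move=> n_gt0 KP De IH x y /dvdzP[x' ->] /dvdzP[y' ->] Hxy.
have e_neq0 : e%:Z != 0.
  by rewrite eqz_nat -lt0n; case: De => en _; apply: dvdn_gt0 en.
rewrite ![_ * e%:Z]mulrC; apply/orb0_restrict => //; apply: IH => d Dd.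
have := Hxy _ (block_modulus_restrict n_gt0 KP De Dd).
by rewrite PoszM ![_ * e%:Z]mulrC !dvdz_mul2l.
Qed.

(** * Orbits with trivial radical in no proper block subgroup *)

Section PrimitiveOrbit.

Variables (n : nat) (K : (int -> int) -> Prop).
Hypotheses (n_gt0 : (0 < n)%N) (KP : zperm_group n K).

Local Notation "x ~ y" := (orb0 n K x y) (at level 70).
Local Notation D := (block_modulus n K).

Hypothesis scale : forall (e : nat) (x y : int), D e -> (1 < e)%N ->
  (e %| x)%Z -> (e %| y)%Z -> (forall d : nat, D d -> (d %| x)%Z = (d %| y)%Z) -> x ~ y.

Variable x : int.
Hypothesis x_prim : forall d : nat, D d -> (d %| x)%Z -> d = 1%N.
Hypothesis x_rad : forall h : int, (forall t, x ~ t -> x ~ h + t) -> (n %| h)%Z.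

(* Here the orbit of [x] is the sum of the orbit of [n/p], which generates
   [E Z/n], and of an orbit generating [F Z/n] with [E * F = n] coprime. *)
Lemma orb0_prim_split (p d0 : nat) : prime p -> (p %| n)%N ->
  D d0 -> (1 < d0)%N -> (d0 %| n %/ p)%N -> x ~ 1.
Proof.
move=> p_pr pn Dd0 d0_gt1 d0np.
have [b [m [cpm m_gt0 nE]]] := pdvd_decomp p_pr n_gt0 pn.
have gE : (n %/ p)%N = (p ^ b * m)%N by rewrite nE mulnAC mulnK ?prime_gt0.
have [v [f [Df rpf fv sumP]]] :=
  orb0_decompose n_gt0 KP p_pr cpm m_gt0 nE x_prim x_rad.
set g := (p ^ b * m)%N in gE sumP.
(* [E] and [F] generate the least block subgroups containing [g] and [v]; both exceed [1], so
   [scale] applies to these two orbits. *)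
have [E DE Emax] := max_block_modulus K n_gt0 g%:Z.
have [F DF Fmax] := max_block_modulus K n_gt0 v.
have rpF : (p ^ b * p %| F)%N by apply: dvdn_trans rpf _; rewrite -Fmax.
have E_gt0 : (0 < E)%N by case: DE => En _; apply: dvdn_gt0 En.
have F_gt0 : (0 < F)%N by case: DF => Fn _; apply: dvdn_gt0 Fn.
have E_gt1 : (1 < E)%N.
  apply: leq_trans d0_gt1 _; apply: dvdn_leq => //.
  by rewrite -Emax // dvdzE /= -gE.
have F_gt1 : (1 < F)%N.
  apply: leq_trans (prime_gt1 p_pr) _; apply: dvdn_leq => //.
  by apply: dvdn_trans rpF; rewrite dvdn_mull.
have Eg : (E %| g%:Z)%Z by rewrite Emax.
have Fv : (F %| v)%Z by rewrite Fmax.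
have gv_x : g%:Z + v ~ x by apply: sumP; apply: (orb0_refl KP).
have cEF : coprime E F.
  apply/eqP; apply: x_prim; first exact: (block_modulus_gcd DE DF).
  rewrite -(orb0_dvd KP (block_modulus_gcd DE DF) gv_x).
  apply: rpredD.
    by apply: dvdz_trans Eg; rewrite dvdzE /= dvdn_gcdl.
  by apply: dvdz_trans Fv; rewrite dvdzE /= dvdn_gcdr.
set L := lcmn E F.
have DL : D L by apply: block_modulus_lcm.
have EL : (E %| L%:Z)%Z by rewrite dvdzE /= dvdn_lcml.
(* [L] is a period of the orbit of [g]. If a block modulus [d] divided [y + L] but not [g], then
   [lcmn d E] would contain the full power of [p]; so would its gcd with [L], which divides [y] and
   hence [g = n / p], a contradiction. *)
have L_Y y : g%:Z ~ y -> g%:Z ~ y + L%:Z.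
  move=> gy; have Ey : (E %| y)%Z by rewrite -(orb0_dvd KP DE gy).
  have EyL : (E %| y + L%:Z)%Z by rewrite rpredD.
  apply: (scale DE) => // d Dd; apply/idP/idP => [dg|dyL].
    have dE : (d %| E)%N by rewrite -Emax.
    by apply: dvdz_trans EyL; rewrite dvdzE.
  apply: contraT => dg; pose d' := lcmn d E.
  have Dd' : D d' by apply: block_modulus_lcm.
  have d'g : ~~ (d' %| g)%N.
    apply: contra dg => d'g; rewrite dvdzE /=.
    by apply: dvdn_trans d'g; apply: dvdn_lcml.
  have rpd' : (p ^ b * p %| d')%N.
    have [d'n _] := Dd'; rewrite nE in d'n.
    exact: dvdn_ppart_full d'n d'g.
  pose d1 := gcdn d' L.
  have Dd1 : D d1 by apply: block_modulus_gcd.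
  have rpd1 : (p ^ b * p %| d1)%N.
    by rewrite dvdn_gcd rpd' (dvdn_trans rpF) // dvdn_lcmr.
  have d1y : (d1 %| y)%Z.
    rewrite -(addrK L%:Z y) rpredB //; last by rewrite dvdzE /= dvdn_gcdr.
    have : (d' %| y + L%:Z)%Z by rewrite dvdz_lcm dyL.
    by apply: dvdz_trans; rewrite dvdzE /= dvdn_gcdl.
  rewrite -(orb0_dvd KP Dd1 gy) in d1y.
  have : (p ^ b * p %| p ^ b * m)%N by apply: dvdn_trans rpd1 _; rewrite dvdzE in d1y.
  rewrite dvdn_pmul2l ?expn_gt0 ?prime_gt0 // => pm.
  by move: cpm; rewrite prime_coprime // pm.
(* Hence [L] is a period of the orbit of [x] too, and [n] divides [L]. *)
have LnE : (E * F)%N = n.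
  apply/eqP; rewrite eqn_dvd -(muln_lcm_gcd E F) (eqP cEF) muln1 -/L.
  have [-> _] := DL; suff : (n %| L%:Z)%Z by rewrite dvdzE.
  apply: x_rad => t xt; have [y [s [-> gy vs]]] := orb0_split KP (orb0_trans KP gv_x xt).
  rewrite addrA [L%:Z + y]addrC; apply: (orb0_sym KP); apply: sumP => //.
  exact: L_Y.
have /coprimezP[[u w] /= uwE] : coprimez E F by rewrite coprimezE.
have dvd_cross (A B : nat) (a b' : int) : (A * B)%N = n -> a * A + b' * B = 1 ->
    forall d : nat, D d -> (d %| a * A)%Z = (d %| A)%N.
  move=> AB abE d [dn _]; apply/idP/idP => [daA|dA]; last first.
    by apply: dvdz_mull; rewrite dvdzE.
  have : (d %| gcdz (a * A) (B%:Z * A))%Z.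
    by rewrite dvdz_gcd daA -PoszM mulnC AB dvdzE.
  rewrite -mulz_gcdl; have /eqP -> : coprimez a B.
    by apply/coprimezP; exists (A%:Z, b') => /=; rewrite mulrC.
  by rewrite mul1r dvdzE.
(* [1 = u * E + w * F], where [u * E] lies in the orbit of [g] and [w * F] in that of [v]. *)
apply: (orb0_sym KP); rewrite -uwE; apply: sumP.
  apply: (scale DE) => //; first exact: dvdz_mull.
  by move=> d Dd; rewrite Emax // (dvd_cross _ _ _ _ LnE uwE).
apply: (scale DF) => //; first exact: dvdz_mull.
move=> d Dd; rewrite Fmax // (dvd_cross F E w u) //; first by rewrite mulnC.
by rewrite addrC.
Qed.

(** Without proper blocks [f = n], so [v] is [0] modulo [n] and the orbit of [n / p] is that of
    [x]. *)
Lemma orb0_prim_cofactor (p : nat) : prime p -> (p %| n)%N ->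
  (forall d, D d -> (1 < d)%N -> d = n) -> (n %/ p)%N%:Z ~ x.
Proof.
move=> p_pr pn Dn.
have [b [m [cpm m_gt0 nE]]] := pdvd_decomp p_pr n_gt0 pn.
have -> : (n %/ p)%N = (p ^ b * m)%N by rewrite nE mulnAC mulnK ?prime_gt0.
have [v [f [Df rpf fv sumP]]] :=
  orb0_decompose n_gt0 KP p_pr cpm m_gt0 nE x_prim x_rad.
rewrite -[_%:Z]addr0; apply: sumP; first exact: (orb0_refl KP).
apply: (orb0_congr KP); rewrite subr0 -(Dn f) //.
have f_gt0 : (0 < f)%N by case: Df => fn _; apply: dvdn_gt0 fn.
apply: leq_trans (prime_gt1 p_pr) _; apply: dvdn_leq => //.
by apply: dvdn_trans rpf; rewrite dvdn_mull.
Qed.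

End PrimitiveOrbit.

(* Muzychuk's theorem on rational Schur rings over cyclic groups, for the
   transitivity module of [K]. *)
Theorem orb0_eq_blocks (n : nat) (K : (int -> int) -> Prop) (x y : int) :
    (0 < n)%N -> zperm_group n K ->
    (forall d, block_modulus n K d -> (d %| x)%Z = (d %| y)%Z) ->
  orb0 n K x y.
Proof.
elim/ltn_ind: n K x y => n IH K x y n_gt0 KP.
have scale (e : nat) (u v : int) : block_modulus n K e -> (1 < e)%N ->
    (e %| u)%Z -> (e %| v)%Z ->
    (forall d : nat, block_modulus n K d -> (d %| u)%Z = (d %| v)%Z) -> orb0 n K u v.
  move=> De e_gt1; apply: orb0_rescale => // {}u {}v; apply: IH.
  - exact: ltn_Pdiv.
  - by case: De => en _; rewrite divn_gt0 ?(ltnW e_gt1) // dvdn_leq.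
  - exact: zperm_group_restrict.
(* For [e > 1] the induction hypothesis on [e Z/n] applies; the remaining [x] and [y] are both shown
   to lie in the orbit of [1]. *)
suff prim u : (forall d : nat, block_modulus n K d -> (d %| u)%Z -> d = 1%N) ->
    orb0 n K u 1.
  move=> Hxy; have [e De emax] := max_block_modulus K n_gt0 x.
  have [e_gt1|] := ltnP 1 e.
    by apply: (scale e) => //; rewrite -?Hxy // emax.
  have e_gt0 : (0 < e)%N by case: De => en _; apply: dvdn_gt0 en.
  move=> e_le1; have e1 : e = 1%N by apply/eqP; rewrite eqn_leq e_le1.
  have xprim d : block_modulus n K d -> (d %| x)%Z -> d = 1%N.
    by move=> Dd; rewrite emax // e1 dvdn1 => /eqP.
  apply: (orb0_trans KP (prim x xprim)); apply: (orb0_sym KP); apply: prim.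
  by move=> d Dd; rewrite -Hxy //; apply: xprim.
move=> u_prim.
have prim1 d : block_modulus n K d -> (d %| 1)%Z -> d = 1%N.
  by move=> _; rewrite dvdz1 => /eqP.
have [n1|n_gt1] : n = 1%N \/ (1 < n)%N.
- by case: (n) n_gt0 => [|[]] //; [left | right].
- by apply: (orb0_congr KP); rewrite n1 dvd1z.
have quo d : block_modulus n K d -> (d < n)%N ->
    exists q : int, orb0 n K u (1 + q * d%:Z).
  move=> Dd dn; have [k [Kk k0 ku]] : orb0 d K u 1.
    apply: IH => //.
    - by case: (Dd) => d_n _; apply: dvdn_gt0 d_n.
    - exact: zperm_group_quotient Dd.
    move=> d' [d'd d'K].
    have Dd' : block_modulus n K d'.
      by split=> //; apply: dvdn_trans d'd _; case: Dd.
    apply/idP/idP => [/(u_prim _ Dd') ->|/(prim1 _ Dd') ->]; exact: dvd1z.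
  have /dvdzP[q qE] : (d %| k u - 1 - k 0)%Z by rewrite rpredB.
  exists q; rewrite -qE.
  have -> : 1 + (k u - 1 - k 0) = k u - k 0 by ring.
  by rewrite -{1}[u]subr0; apply: orb0_sub.
have rad_or v : (exists2 d, block_modulus n K d &
        (d < n)%N /\ forall t q : int, orb0 n K v t -> orb0 n K v (t + q * d%:Z))
    \/ forall h : int, (forall t, orb0 n K v t -> orb0 n K v (h + t)) -> (n %| h)%Z.
  have [H|H] := boolp.EM (forall h : int,
    (forall t, orb0 n K v t -> orb0 n K v (h + t)) -> (n %| h)%Z); first by right.
  left; have [h Hh nh] : exists2 h : int,
    (forall t, orb0 n K v t -> orb0 n K v (h + t)) & ~~ (n %| h)%Z.
    apply: boolp.contrapT => Nh; apply: H => h Hh; apply: contraT => nh.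
    by case: Nh; exists h.
  by have [d [Dd dn dP]] := radical_block n_gt0 KP Hh nh; exists d.
(* By induction in Z/d, [u] is equivalent to some [1 + q * d]; a period [d < n] of the orbit of [u]
   or of [1] absorbs [q * d]. *)
have [[d Dd [dn dP]]|u_rad] := rad_or u.
  have [q uq] := quo d Dd dn; have := dP _ (- q) uq.
  by rewrite mulNr addrK.
have [[d Dd [dn dP]]|rad1] := rad_or 1.
  have [q uq] := quo d Dd dn; apply: (orb0_trans KP uq); apply: (orb0_sym KP).
  by apply: dP; apply: (orb0_refl KP).
have [[p [d [p_pr pn [Dd d_gt1 dnp]]]]|Np] := boolp.EM (exists p d : nat,
    [/\ prime p, (p %| n)%N & [/\ block_modulus n K d, (1 < d)%N & (d %| n %/ p)%N]]).
  exact: (orb0_prim_split n_gt0 KP scale u_prim u_rad p_pr pn Dd d_gt1 dnp).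
(* A block modulus [1 < d < n] would divide [n / p] for every prime [p] dividing [n / d]. *)
have Dn d : block_modulus n K d -> (1 < d)%N -> d = n.
  move=> Dd d_gt1; have [dn _] := Dd; apply/eqP; apply: contraT => neq_dn.
  have d_gt0 := ltnW d_gt1.
  have nd_gt1 : (1 < n %/ d)%N.
    rewrite ltn_neqAle divn_gt0 // dvdn_leq // andbT.
    by apply: contra neq_dn => /eqP nd1; rewrite -(divnK dn) -nd1 mul1n.
  case: Np; exists (pdiv (n %/ d)), d; split; first exact: pdiv_prime.
    by apply: dvdn_trans (pdiv_dvd _) _; rewrite -{2}(divnK dn) dvdn_mulr.
  split=> //; rewrite dvdn_divRL; last first.
    by apply: dvdn_trans (pdiv_dvd _) _; rewrite -{2}(divnK dn) dvdn_mulr.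
  by rewrite -{2}(divnK dn) mulnC dvdn_pmul2r // pdiv_dvd.
(* No proper blocks remain, so [n / p] lies in the orbits of both [u] and [1]. *)
have p_pr := pdiv_prime n_gt1; have pn := pdiv_dvd n.
apply: (@orb0_trans _ _ KP (n %/ pdiv n)%N%:Z).
  by apply: (orb0_sym KP); apply: (orb0_prim_cofactor n_gt0 KP u_prim u_rad).
exact: (orb0_prim_cofactor n_gt0 KP prim1 rad1).
Qed.

(** * Roots of unity and Galois conjugation *)

Section EpsPrimitive.

Variable n : nat.
Hypothesis n_gt0 : (0 < n)%N.
Let w : algC := n.-root (-1).

Let wn : w ^+ n = -1. Proof. exact: rootCK. Qed.

(** [n.-root] selects a root of largest real part among those with nonnegative imaginary part;
    conjugation covers the others. *)
Lemma Re_rootCN1_max (y : algC) : y ^+ n = -1 -> 'Re y <= 'Re w.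
Proof.
move=> yn; have [Iy|Iy] := real_ge0P (Creal_Im y).
  exact: rootC_Re_max.
rewrite -Re_conj; apply: rootC_Re_max => //; last by rewrite Im_conj oppr_ge0 ltW.
by rewrite -rmorphXn yn rmorphN1.
Qed.

(* Multiplication by [w] moves no root of unity strictly across the real axis:
   since [Re (w * s^2) <= Re w], the product below is nonnegative. *)
Lemma Im_mul_rootCN1 (s : algC) : s ^+ n.*2 = 1 -> 0 <= 'Im s * 'Im (w * s).
Proof.
move=> s1; have ns : `|s| = 1.
  apply/eqP; rewrite -(@pexpr_eq1 _ _ n.*2) ?double_gt0 //.
  by rewrite -normrX s1 normr1.
have := @Re_rootCN1_max (w * s ^+ 2).
rewrite exprMn -exprM mul2n s1 mulr1 => /(_ wn); rewrite -subr_ge0.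
have ns2 : 'Re s ^+ 2 + 'Im s ^+ 2 = 1 by rewrite -normC2_Re_Im ns expr1n.
have key (a b c d : algC) : c ^+ 2 + d ^+ 2 = 1 ->
    a - (a * (c * c - d * d) - b * (c * d + c * d)) = 2 * (d * (a * d + c * b)).
  move=> cd; apply/eqP; rewrite -subr_eq0.
  have -> : a - (a * (c * c - d * d) - b * (c * d + c * d))
    - 2 * (d * (a * d + c * b)) = a * (1 - (c ^+ 2 + d ^+ 2)) by ring.
  by rewrite cd subrr mulr0.
by rewrite expr2 !(ReM, ImM) key // pmulr_rge0 // ltr0n.
Qed.

(** If some [w ^+ k * t] is real, it is [1] or [-1 = w ^+ n]. Otherwise all their imaginary parts
    have the same sign by [Im_mul_rootCN1], although [w ^+ n * t = - t]. *)
Lemma rootCN1_generates (t : algC) : t ^+ n.*2 = 1 -> exists k, t = w ^+ k.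
Proof.
move=> t1; have w2n : w ^+ n.*2 = 1 by rewrite -muln2 exprM wn sqrrN expr1n.
pose s k := w ^+ k * t.
have s1 k : s k ^+ n.*2 = 1 by rewrite exprMn t1 mulr1 exprAC w2n expr1n.
have sE k : t = s k * w ^+ (n.*2.-1 * k).
  rewrite /s mulrAC -exprD -{1}[k]mul1n -mulnDl add1n prednK ?double_gt0 //.
  by rewrite exprM w2n expr1n mul1r.
have [[k /eqP Ik]|Is] := boolp.EM (exists k, 'Im (s k) == 0).
  have Rs : s k \is Creal by apply/Creal_ImP.
  have : s k ^+ 2 == 1.
    rewrite -real_normK // sqrf_eq1; apply/orP; left.
    by rewrite -(@pexpr_eq1 _ _ n.*2) ?double_gt0 // -normrX s1 normr1.
  rewrite sqrf_eq1 => /orP[] /eqP sk.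
    by exists (n.*2.-1 * k)%N; rewrite {1}(sE k) sk mul1r.
  by exists (n + n.*2.-1 * k)%N; rewrite {1}(sE k) sk exprD wn.
have Im0 k : 'Im (s k) != 0 by apply/negP => H; apply: Is; exists k.
have pos k : 0 < 'Im (s 0%N) * 'Im (s k).
  elim: k => [|k IHk].
    by rewrite -expr2 real_exprn_even_gt0 //= ?Im0 ?orbT // Creal_Im.
  have step : 0 < 'Im (s k) * 'Im (s k.+1).
    rewrite lt_def mulf_neq0 ?Im0 //= /s exprS -mulrA.
    exact: (Im_mul_rootCN1 (s1 k)).
  have sq : 0 < 'Im (s k) ^+ 2.
    by rewrite real_exprn_even_gt0 //= ?Im0 ?orbT // Creal_Im.
  rewrite -(pmulr_rgt0 _ sq); have -> : 'Im (s k) ^+ 2 * ('Im (s 0%N) * 'Im (s k.+1))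
    = ('Im (s 0%N) * 'Im (s k)) * ('Im (s k) * 'Im (s k.+1)) by ring.
  exact: mulr_gt0.
have := pos n; have := pos 0%N; rewrite /s wn expr0 mul1r mulN1r raddfN mulrN.
by rewrite oppr_gt0 => /lt_trans lt0 /lt0; rewrite ltxx.
Qed.

Lemma eps_primitive : n.-primitive_root (eps n).
Proof.
have w2n : w ^+ n.*2 = 1 by rewrite -muln2 exprM wn sqrrN expr1n.
have n2_gt0 : (0 < n.*2)%N by rewrite double_gt0.
have [z zP] := C_prim_root_exists n2_gt0.
have [k zE] := rootCN1_generates (prim_expr_order zP).
have eps1 : eps n ^+ n = 1 by rewrite /eps -exprM mul2n.
have [d dP dn] := prim_order_exists n_gt0 eps1.
(* The primitive [2n]-th root [z] is a power of [w], and [eps n = w ^+ 2] has order [d]; hence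
   [z ^+ (2 * d) = 1]. *)
suff nd : n = d by rewrite [X in X.-primitive_root _]nd.
apply/eqP; rewrite eqn_dvd dn andbT -(dvdn_pmul2l (ltn0Sn 1)) !mul2n.
rewrite (prim_order_dvd zP) zE exprAC -mul2n exprM -/w.
by rewrite [w ^+ 2]/(eps n) (prim_expr_order dP) expr1n.
Qed.

End EpsPrimitive.

(** * Fourier transform and idempotent circulants *)

Section Fourier.

Variables (m : nat) (z : algC).
Local Notation n := m.+1.
Hypothesis zP : n.-primitive_root z.

Lemma prim_root_congr (a b : nat) : (n %| a%:Z - b%:Z)%Z -> z ^+ a = z ^+ b.
Proof.
move=> ab; apply/eqP; rewrite (eq_prim_root_expr zP).
by rewrite -eqz_nat -!modz_nat eqz_mod_dvd.
Qed.

(** The [a k] are the coefficients of a polynomial of degree below [n] vanishing at the [n] distinct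
    powers of [z]. *)
Lemma fourier_inj (a : 'I_n -> algC) :
  (forall r : nat, (r < n)%N -> \sum_(k < n) a k * z ^+ (k * r) = 0) ->
  forall k, a k = 0.
Proof.
move=> a0 k; pose q := \poly_(i < n) a (inord i).
have q0 : q = 0.
  apply/eqP; apply: contraT => q_neq0.
  have := @max_poly_roots _ q [seq z ^+ r | r <- iota 0 n] q_neq0.
  rewrite size_map size_iota ltnNge size_poly; apply.
    apply/allP => x /mapP[r]; rewrite mem_iota => /andP[_ rn] ->.
    rewrite /root horner_poly; apply/eqP; rewrite -[RHS](a0 r) //.
    by apply: eq_bigr => i _; rewrite inord_val -exprM mulnC.
  rewrite map_inj_in_uniq ?iota_uniq // => r s; rewrite !mem_iota /= => rn sn.
  by move/eqP; rewrite (eq_prim_root_expr zP) !modn_small // => /eqP.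
by have := coef_poly n (fun i => a (inord i)) k; rewrite -/q q0 coef0 ltn_ord inord_val.
Qed.

End Fourier.

Section Circulant.

Variables (m : nat) (f : int -> rat).
Local Notation n := m.+1.
Hypothesis f_per : forall x y : int, (n %| x - y)%Z -> f x = f y.

Definition circ_mx : 'M[rat]_n := \matrix_(i, j) f ((j : nat)%:Z - (i : nat)%:Z).

Definition fourier (z : algC) (r : nat) : algC :=
  \sum_(k < n) ratr (f (k : nat)%:Z) * z ^+ (k * r).

Lemma zres_addK_inj (a : int) : injective (fun k : 'I_n => zres m ((k : nat)%:Z + a)).
Proof.
move=> k l /eqP; rewrite -eq_zres opprD addrACA subrr addr0.
by rewrite zres_eq zres_nat => /eqP.
Qed.

Lemma zres_mul_inj (u : int) : coprimez u n ->
  injective (fun k : 'I_n => zres m (u * (k : nat)%:Z)).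
Proof.
move=> cu k l /eqP; rewrite -eq_zres -mulrBr Gauss_dvdzr; last by rewrite coprimez_sym.
by rewrite zres_eq zres_nat => /eqP.
Qed.

(** Idempotence says that [f] is its own convolution square, and the transform turns convolution
    into product. *)
Lemma fourier_idem (z : algC) (r : nat) : n.-primitive_root z ->
  circ_mx *m circ_mx = circ_mx -> fourier z r ^+ 2 = fourier z r.
Proof.
move=> zP PP.
have fE (k : 'I_n) : f (k : nat)%:Z =
    \sum_(l < n) f (l : nat)%:Z * f ((k : nat)%:Z - (l : nat)%:Z).
  have := congr1 (fun M : 'M_n => M (zres m 0) k) PP; rewrite !mxE.
  have z0 (x : int) : f (x - (zres m 0 : nat)%:Z) = f x.
    apply: f_per; rewrite addrAC subrr add0r rpredN.
    by have := zresP m 0; rewrite subr0.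
  by rewrite z0 => <-; apply: eq_bigr => l _; rewrite !mxE z0.
rewrite expr2 {1}/fourier mulr_suml [RHS]/fourier.
under [RHS]eq_bigr => k _ do rewrite fE rmorph_sum mulr_suml.
rewrite [RHS]exchange_big /=; apply: eq_bigr => l _.
rewrite [RHS](reindex_inj (@zres_addK_inj (l : nat)%:Z)) /= /fourier mulr_sumr.
apply: eq_bigr => k _; set k' := zres _ _.
have k'P : (n %| (k' : nat)%:Z - ((k : nat)%:Z + (l : nat)%:Z))%Z by apply: zresP.
have -> : f ((k' : nat)%:Z - (l : nat)%:Z) = f (k : nat)%:Z.
  apply: f_per.
  by have -> : (k' : nat)%:Z - (l : nat)%:Z - (k : nat)%:Z =
    (k' : nat)%:Z - ((k : nat)%:Z + (l : nat)%:Z) by ring.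
have -> : z ^+ (k' * r) = z ^+ (l * r) * z ^+ (k * r).
  rewrite -exprD -mulnDl; apply: (prim_root_congr zP).
  by rewrite !PoszM -mulrBl PoszD [(l : nat)%:Z + _]addrC dvdz_mulr.
by rewrite rmorphM /= mulrACA.
Qed.

Lemma circ_idem_unit (u z : int) : circ_mx *m circ_mx = circ_mx ->
  coprimez u n -> f (u * z) = f z.
Proof.
move=> PP cu; pose v : nat := zres m u.
have vu : (n %| v%:Z - u)%Z by apply: zresP.
have cv : coprime v n.
  have : gcdz v n = gcdz u n by apply: gcdz_congr.
  by rewrite (eqP cu) /gcdz => -[] /eqP.
have [w wP] := C_prim_root_exists (ltn0Sn m).
have idem r : fourier w r = 0 \/ fourier w r = 1.
  have /eqP := fourier_idem r wP PP; rewrite expr2 -subr_eq0 -{3}[fourier w r]mulr1.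
  by rewrite -mulrBr mulf_eq0 subr_eq0 => /orP[] /eqP; [left | right].
have galois r : fourier w (v * r) = fourier w r.
  have [s sP] := Qn_aut_exists cv.
  have -> : fourier w (v * r) = s (fourier w r).
    rewrite /fourier rmorph_sum; apply: eq_bigr => k _.
    rewrite rmorphM fmorph_rat; congr (_ * _); rewrite sP.
      by rewrite -exprM mulnCA mulnC.
    by rewrite -exprM mulnC exprM (prim_expr_order wP) expr1n.
  by case: (idem r) => ->; rewrite ?rmorph0 ?rmorph1.
have wvP : n.-primitive_root (w ^+ v) by rewrite prim_root_exp_coprime.
have cv' : coprimez v n by rewrite coprimezE.
(* Transformed with respect to [w ^+ v], the function [f (v * k)] yields [fourier w r] and [f]
   yields [fourier w (v * r)]. *)
pose d (k : 'I_n) : algC := ratr (f (v%:Z * (k : nat)%:Z)) - ratr (f (k : nat)%:Z).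
have d0 : forall k, d k = 0.
  apply: (fourier_inj wvP) => r _.
  under eq_bigr => k _ do rewrite /d mulrBl -exprM mulnCA.
  rewrite sumrB; apply/eqP; rewrite subr_eq0; apply/eqP.
  rewrite -[RHS]/(fourier w (v * r)) galois [RHS]/fourier.
  rewrite [RHS](reindex_inj (zres_mul_inj cv')) /=; apply: eq_bigr => k _.
  have kP := zresP m (v%:Z * (k : nat)%:Z); congr (ratr _ * _).
    by apply: f_per; rewrite -opprB rpredN.
  apply/esym/(prim_root_congr wP); rewrite !PoszM mulrA -mulrBl dvdz_mulr //.
  by rewrite [(k : nat)%:Z * _]mulrC.
have zP := zresP m z.
have -> : f z = f (zres m z : nat)%:Z by apply: f_per; rewrite -opprB rpredN.
have -> : f (u * z) = f (v%:Z * (zres m z : nat)%:Z).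
  apply: f_per.
  have -> : u * z - v%:Z * (zres m z : nat)%:Z =
     - ((v%:Z - u) * z + v%:Z * ((zres m z : nat)%:Z - z)) by ring.
  by rewrite rpredN; apply: rpredD; [exact: dvdz_mulr | exact: dvdz_mull].
apply: (fmorph_inj (ratr : rat -> algC)); apply/eqP; rewrite -subr_eq0.
by rewrite -/(d _) d0.
Qed.

End Circulant.

(** * Invariant subspaces of the permutation module *)

Lemma modn_dvdz (d i j : nat) : (i %% d == j %% d)%N = (d %| i%:Z - j%:Z)%Z.
Proof. by rewrite -eqz_nat -!modz_nat eqz_mod_dvd. Qed.

Lemma mulmx_permE (R : nzRingType) (k n : nat) (A : 'M[R]_(k, n)) (g : 'S_n) i j :
  (A *m perm_mx g) i j = A i ((g^-1)%g j).
Proof. by rewrite -{1}[g]invgK -col_permE mxE. Qed.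

Lemma VperP (k n d : nat) (A : 'M[rat]_(k, n)) : (0 < n)%N -> (d %| n)%N ->
  reflect (forall i (j j' : 'I_n), (d %| (j : nat)%:Z - (j' : nat)%:Z)%Z -> A i j = A i j')
    (A <= Vper n d)%MS.
Proof.
move=> n_gt0 dn; have d_gt0 := dvdn_gt0 n_gt0 dn.
apply: (iffP idP) => [/submxP[B ->] i j j'|Aper].
  rewrite -modn_dvdz => /eqP jj'; rewrite !mxE; apply: eq_bigr => l _.
  by rewrite !mxE jj'.
(* The first [d] rows of [Vper n d] represent each residue class once; the other coefficients are
   [0]. *)
apply/submxP; exists (\matrix_(i, j) if (j < d)%N then A i j else 0).
apply/matrixP => i j; rewrite !mxE.
have jd : (j %% d < n)%N by apply: leq_trans (ltn_pmod _ d_gt0) (dvdn_leq _ _).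
rewrite (bigD1 (Ordinal jd)) //= !mxE /= ltn_pmod // modn_mod eqxx mulr1.
rewrite big1 ?addr0 => [|l Hl]; last first.
  rewrite !mxE; case: ifP => [ld|]; last by rewrite mul0r.
  rewrite [(l %% d)%N]modn_small //; case: eqP => [jl|]; last by rewrite mulr0.
  by case/eqP: Hl; apply: val_inj.
by apply: Aper; rewrite -modn_dvdz /= modn_mod.
Qed.

Section Blocks.

Variables (m : nat) (G : {group 'S_m.+1}).
Local Notation n := m.+1.

Definition zlift (k : int -> int) : Prop :=
  exists2 g, g \in G & forall z, k z = (g (zres m z) : nat)%:Z.

Lemma inD_blockP (d : nat) : reflect (block_modulus n zlift d) (inD G d).
Proof.
apply: (iffP andP) => -[dn]; last first.
  move=> dK; split=> //; apply/forallP => g; apply/implyP => gG.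
  apply/VperP => // i j j' djj'; rewrite !mulmx_permE !mxE; congr (_%:R).
  have Kg : zlift (fun z => ((g^-1)%g (zres m z) : nat)%:Z).
    by exists (g^-1)%g; rewrite ?groupV.
  have := dK _ Kg _ _ djj'; rewrite !zres_nat -modn_dvdz => /eqP ->.
  by [].
move=> /forallP ginvG; split=> // k [g gG kE] x y dxy; rewrite !kE.
have dvd_n z : (n %| z)%Z -> (d %| z)%Z by apply: dvdz_trans; rewrite dvdzE.
have dres : (d %| (zres m x : nat)%:Z - (zres m y : nat)%:Z)%Z.
  have -> : (zres m x : nat)%:Z - (zres m y : nat)%:Z =
    ((zres m x : nat)%:Z - x) - ((zres m y : nat)%:Z - y) + (x - y) by ring.
  by apply: rpredD => //; apply: rpredB; apply/dvd_n/zresP.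
have gVG : (g^-1)%g \in G by rewrite groupV.
have := implyP (ginvG (g^-1)%g) gVG => /(VperP _ (ltn0Sn m) dn) per.
(* The row indexed by the image of [y] has entry [1] in the column of [y], hence also in that of
   [x]. *)
have := per (g (zres m y)) _ _ dres; rewrite !mulmx_permE invgK !mxE eqxx.
by case: eqP => // + _ => /eqP; rewrite modn_dvdz.
Qed.

Lemma inD_dvdn (d : nat) : inD G d -> (d %| n)%N.
Proof. by case/andP. Qed.

Lemma inD_gt0 (d : nat) : inD G d -> (0 < d)%N.
Proof. by move/inD_dvdn; apply: dvdn_gt0. Qed.

Lemma inD_leq (d : nat) : inD G d -> (d < n.+1)%N.
Proof. by move/inD_dvdn => dn; rewrite ltnS dvdn_leq. Qed.

Lemma inD_full : inD G n.
Proof.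
apply/inD_blockP; split=> // k [g gG kE] x y nxy; rewrite !kE.
have /eqP -> : zres m x == zres m y by rewrite -eq_zres.
by rewrite subrr dvdz0.
Qed.

Lemma inD_gcd (d e : nat) : inD G d -> inD G e -> inD G (gcdn d e).
Proof. by move=> /inD_blockP Dd /inD_blockP De; apply/inD_blockP/block_modulus_gcd. Qed.

Lemma inD_max : exists E : int -> nat, forall z, inD G (E z) /\
  forall d : nat, inD G d -> (d %| z)%Z = (d %| E z)%N.
Proof.
suff H z : exists e : nat, inD G e /\
    forall d : nat, inD G d -> (d %| z)%Z = (d %| e)%N.
  by have [E EP] := boolp.choice H; exists E.
have [e De emax] := max_block_modulus zlift (ltn0Sn m) z.
exists e; split; first exact/inD_blockP.
by move=> d /inD_blockP/emax.
Qed.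

Lemma covers_above (d l : nat) : inD G d -> inD G l -> (l %| d)%N -> (l < d)%N ->
  exists2 dt : nat, covers G d dt & (l %| dt)%N.
Proof.
move=> Dd Dl ld lt_ld.
pose P (e : nat) := [&& inD G e, (l %| e)%N, (e %| d)%N & (e < d)%N].
have exP : exists e, P e by exists l; rewrite /P Dl dvdnn ld lt_ld.
have ubP e : P e -> (e <= d)%N by case/and4P => _ _ _ /ltnW.
case: (ex_maxnP exP ubP) => e /and4P[De le ed lt_ed] emax; exists e => //.
rewrite /covers Dd De ed lt_ed /=; apply/existsP => -[k /and5P[Dk ek kd edk kdd]].
have : (k <= e)%N.
  by apply: emax; rewrite /P Dk (dvdn_trans le edk) kdd.
by rewrite leqNgt ek.
Qed.

Section Invariant.

Variable f : int -> rat.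
Hypothesis f_per : forall x y : int, (n %| x - y)%Z -> f x = f y.
Hypothesis f_inv : forall g, g \in G -> forall i j : 'I_n,
  f ((g j : nat)%:Z - (g i : nat)%:Z) = f ((j : nat)%:Z - (i : nat)%:Z).
Hypothesis f_idem : circ_mx m f *m circ_mx m f = circ_mx m f.

Definition circ_aut (k : int -> int) : Prop := exists2 s : 'S_n,
  forall z, zres m (k z) = s (zres m z) &
  forall i j : 'I_n, f ((s j : nat)%:Z - (s i : nat)%:Z) = f ((j : nat)%:Z - (i : nat)%:Z).

Let f_zres (x y : int) : f ((zres m x : nat)%:Z - (zres m y : nat)%:Z) = f (x - y).
Proof.
apply: f_per.
have -> : (zres m x : nat)%:Z - (zres m y : nat)%:Z - (x - y) =
  ((zres m x : nat)%:Z - x) - ((zres m y : nat)%:Z - y) by ring.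
by rewrite rpredB // zresP.
Qed.

Let zres_perm (k : int -> int) (k_inj : injective (fun i : 'I_n => zres m (k (i : nat)%:Z))) :
  (forall x y : int, (n %| x - y)%Z -> (n %| k x - k y)%Z) ->
  (forall x y, f (k x - k y) = f (x - y)) -> circ_aut k.
Proof.
move=> kP kf; exists (perm k_inj) => [z|i j]; rewrite !permE.
  by apply/eqP; rewrite eq_sym -eq_zres kP // zresP.
by rewrite f_zres kf.
Qed.

(** Translations belong because the matrix is circulant, multiplications by units because it is
    idempotent; by [gcdz_eq_unit] the latter connect elements of equal gcd. *)
Lemma circ_aut_group : zperm_group n circ_aut.
Proof.
split.
- by move=> k [s ks _] x y; rewrite !eq_zres !ks => /eqP ->.
- move=> k h [s ks sf] [t ht tf]; exists (t * s)%g => [z|i j] /=.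
    by rewrite permM ks ht.
  by rewrite !permM sf tf.
- move=> a; apply: zres_perm; first exact: zres_addK_inj.
    by move=> x y; rewrite opprD addrACA subrr addr0.
  by move=> x y; rewrite opprD addrACA subrr addr0.
- move=> k [s ks sf]; exists (fun z => ((s^-1)%g (zres m z) : nat)%:Z).
    exists (s^-1)%g => [z|i j]; first by rewrite zres_nat.
    by rewrite -(sf ((s^-1)%g i)) !permKV.
  by move=> x; rewrite eq_zres zres_nat ks permK.
- move=> x y /gcdz_eq_unit[] // u cu uxy; exists (fun z => u * z); split=> //.
    apply: zres_perm; first exact: zres_mul_inj.
      by move=> a b ab; rewrite -mulrBr dvdz_mull.
    by move=> a b; rewrite -mulrBr (circ_idem_unit f_per).
  by rewrite mulr0 dvdz0.
Qed.

(** [G] acts through [circ_aut], so the block moduli of [circ_aut] lie in D(G), and [orb0_eq_blocks]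
    yields an automorphism of [f] fixing [0] and moving [x] to [y]. *)
Lemma circ_block_const (x y : int) :
  (forall d : nat, inD G d -> (d %| x)%Z = (d %| y)%Z) -> f x = f y.
Proof.
move=> Hxy; have [k [[s ks sf] k0 kx]] : orb0 n circ_aut x y.
  apply: orb0_eq_blocks => //; first exact: circ_aut_group.
  move=> d [dn dK]; apply: Hxy; apply/inD_blockP; split=> // k [g gG kE] u v.
  apply: dK; exists g; last exact: f_inv.
  by move=> z; rewrite kE zres_nat.
have s0 : s (zres m 0) = zres m 0 by apply/eqP; rewrite -ks -eq_zres subr0.
have sx : s (zres m x) = zres m y by apply/eqP; rewrite -ks -eq_zres.
by have := sf (zres m 0) (zres m x); rewrite s0 sx !f_zres !subr0.
Qed.

End Invariant.

End Blocks.

(** * Orthogonal projections over the rationals *)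

Section RationalOrthogonality.

Variable n : nat.
Implicit Types (u v w : 'rV[rat]_n) (S : 'M[rat]_n).

Lemma mulmx_tr_eq0 w : w *m w^T = 0 -> w = 0.
Proof.
move=> /matrixP/(_ 0 0); rewrite !mxE => ww; apply/rowP => j; rewrite mxE.
have sq_ge0 i : true -> 0 <= w 0 i * w^T i 0 by rewrite mxE -expr2 sqr_ge0.
by move: (psumr_eq0P sq_ge0 ww (i := j) isT) => /eqP; rewrite mxE mulf_eq0 orbb => /eqP.
Qed.

Lemma sub_kermx_trP k l (A : 'M[rat]_(k, n)) (B : 'M[rat]_(l, n)) S :
  (A <= S)%MS -> (B <= kermx S^T)%MS -> B *m A^T = 0.
Proof.
by case/submxP => C ->; move/sub_kermxP; rewrite trmx_mul mulmxA => ->; rewrite mul0mx.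
Qed.

Lemma orth_cap0 S : (S :&: kermx S^T)%MS = 0.
Proof.
apply/eqP/rowV0P => v; rewrite sub_capmx => /andP[vS vK].
exact/mulmx_tr_eq0/(sub_kermx_trP vS vK).
Qed.

Lemma orth_full S k (A : 'M[rat]_(k, n)) : (A <= S + kermx S^T)%MS.
Proof.
apply: submx_full; rewrite /row_full mxrank_disjoint_sum ?orth_cap0 //.
by rewrite mxrank_ker mxrank_tr subnKC // rank_leq_row.
Qed.

Lemma orth_perm_stable S (g : 'S_n) : (S *m perm_mx g^-1 <= S)%MS ->
  (kermx S^T *m perm_mx g <= kermx S^T)%MS.
Proof.
case/submxP => B SB; apply/sub_kermxP; rewrite -mulmxA.
have -> : perm_mx g *m S^T = S^T *m B^T.
  by rewrite -trmx_mul -SB trmx_mul tr_perm_mx invgK.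
by rewrite mulmxA mulmx_ker mul0mx.
Qed.

Lemma proj_perm_comm S (g : 'S_n) : (S *m perm_mx g <= S)%MS ->
    (S *m perm_mx g^-1 <= S)%MS ->
  proj_mx S (kermx S^T) *m perm_mx g = perm_mx g *m proj_mx S (kermx S^T).
Proof.
move=> Sg SgV; set P := proj_mx _ _.
have [Q QE] : exists Q, Q = 1%:M - P by eexists.
have dec : 1%:M = P + Q by rewrite QE addrC subrK.
have PS : (P <= S)%MS by rewrite -[P]mul1mx proj_mx_sub.
have QK : (Q <= kermx S^T)%MS.
  by rewrite QE -{1}[P]mul1mx; apply: proj_mx_compl_sub; apply: orth_full.
rewrite -[X in _ = X *m _]mul1mx [in RHS]dec !mulmxDl.
rewrite [P *m _ *m P]proj_mx_id ?orth_cap0 //; last first.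
  by apply: submx_trans Sg; apply: submxMr.
rewrite [Q *m _ *m P]proj_mx_0 ?orth_cap0 ?addr0 //.
by apply: submx_trans (orth_perm_stable SgV); apply: submxMr.
Qed.

End RationalOrthogonality.

(** * Algebra of the matrices [Vper] *)

Section PeriodicVectors.

Variable m : nat.
Local Notation n := m.+1.
Implicit Types (d e : nat) (u : 'rV[rat]_n).

Lemma VperE d (i j : 'I_n) :
  Vper n d i j = ((d %| (j : nat)%:Z - (i : nat)%:Z)%Z)%:R.
Proof. by rewrite mxE modn_dvdz. Qed.

Lemma tr_Vper d : (Vper n d)^T = Vper n d.
Proof. by apply/matrixP => i j; rewrite !mxE eq_sym. Qed.

Lemma dvdz_zres d (x y : int) : (d %| n)%N ->
  (d %| (zres m x : nat)%:Z - y)%Z = (d %| x - y)%Z.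
Proof.
move=> dn; have dx : (d %| (zres m x : nat)%:Z - x)%Z.
  by apply: dvdz_trans (zresP m x); rewrite dvdzE.
by rewrite -[in LHS](subrKA x) rpredDl.
Qed.

Lemma Vper_comm d e : (d %| n)%N -> (e %| n)%N ->
  Vper n d *m Vper n e = Vper n e *m Vper n d.
Proof.
move=> dn en; apply/matrixP => i j; rewrite !mxE.
(* The reflection of [k] to [i + j - k] exchanges the two factors. *)
pose s (k : 'I_n) := zres m ((i : nat)%:Z + (j : nat)%:Z - (k : nat)%:Z).
have s_inj : injective s.
  move=> k l /eqP; rewrite -eq_zres => H; apply/eqP.
  rewrite -[l]zres_nat -zres_eq -rpredN.
  by have -> : - ((k : nat)%:Z - (l : nat)%:Z) = (i : nat)%:Z + (j : nat)%:Z - (k : nat)%:Z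
    - ((i : nat)%:Z + (j : nat)%:Z - (l : nat)%:Z) by ring.
rewrite (reindex_inj s_inj) /=; apply: eq_bigr => k _; rewrite !VperE mulrC.
congr (_%:R * _%:R).
  rewrite -rpredN opprB dvdz_zres //.
  have -> : (i : nat)%:Z + (j : nat)%:Z - (k : nat)%:Z - (j : nat)%:Z =
    - ((k : nat)%:Z - (i : nat)%:Z) by ring.
  by rewrite rpredN.
rewrite dvdz_zres //.
by have -> : (i : nat)%:Z + (j : nat)%:Z - (k : nat)%:Z - (i : nat)%:Z =
  (j : nat)%:Z - (k : nat)%:Z by ring.
Qed.

Lemma sum_Vper d (j : 'I_n) : (d %| n)%N -> \sum_(k < n) Vper n d k j = (n %/ d)%N%:R.
Proof.
move=> dn; have d_gt0 : (0 < d)%N by apply: dvdn_gt0 dn.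
rewrite -(sum_dvdz_block _ (n %/ d) (j : nat)%:Z d_gt0) mulnC divnK // [RHS]big_mkcond.
apply: eq_bigr => k _; rewrite VperE -opprB rpredN.
by case: ifP.
Qed.

Lemma Vper_gcd k (A : 'M[rat]_(k, n)) d e : (d %| n)%N -> (e %| n)%N ->
  (A <= Vper n d)%MS -> (A <= Vper n e)%MS -> (A <= Vper n (gcdn d e))%MS.
Proof.
move=> dn en /(VperP _ (ltn0Sn m) dn) Ad /(VperP _ (ltn0Sn m) en) Ae.
have gn : (gcdn d e %| n)%N by apply: dvdn_trans (dvdn_gcdl _ _) dn.
apply/VperP => // i j j' /dvdzP[q qE]; have [a [b abE]] := Bezoutz d e.
(* [l] is congruent to [j'] modulo [e] and, by Bezout, to [j] modulo [d]. *)
pose l := zres m ((j' : nat)%:Z + q * b * e%:Z).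
have lj' : A i l = A i j'.
  by apply: Ae; rewrite dvdz_zres // addrC addKr dvdz_mull.
rewrite -lj'; apply/esym; apply: Ad; rewrite dvdz_zres //.
have -> : (j' : nat)%:Z + q * b * e%:Z - (j : nat)%:Z = - (q * a) * d%:Z.
  have -> : (j : nat)%:Z = (j' : nat)%:Z + ((j : nat)%:Z - (j' : nat)%:Z) by ring.
  by rewrite qE -[(gcdn d e)%:Z]/(gcdz d e) -abE; ring.
exact: dvdz_mull.
Qed.

Lemma Vper_mono k (A : 'M[rat]_(k, n)) d e : (d %| e)%N -> (e %| n)%N ->
  (A <= Vper n d)%MS -> (A <= Vper n e)%MS.
Proof.
move=> de en /(VperP _ (ltn0Sn m) (dvdn_trans de en)) Ad; apply/VperP => // i j j' ejj'.
by apply: Ad; apply: dvdz_trans ejj'; rewrite dvdzE.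
Qed.

(** [Vper n d] is [n / d] times the orthogonal projector onto V_d. *)
Lemma mul_Vper_per u d : (d %| n)%N -> (u <= Vper n d)%MS ->
  u *m Vper n d = (n %/ d)%N%:R *: u.
Proof.
move=> dn /(VperP _ (ltn0Sn m) dn) uper; apply/rowP => j; rewrite !mxE.
rewrite -(sum_Vper j dn) mulr_suml; apply: eq_bigr => k _.
rewrite mulrC VperE; case: (boolP (_ \in _)) => [|_]; last by rewrite !mul0r.
by move=> djk; rewrite !mul1r; apply: uper; rewrite -opprB rpredN.
Qed.

Lemma mul_Vper_sub k (A : 'M[rat]_(k, n)) d e : (d %| n)%N -> (e %| n)%N ->
  (A <= Vper n e)%MS -> (A *m Vper n d <= Vper n e)%MS.
Proof.
move=> dn en /submxP[B ->]; rewrite -mulmxA Vper_comm // mulmxA.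
exact: submxMl.
Qed.

End PeriodicVectors.

Lemma perm_comm_entry (R : nzRingType) (n : nat) (P : 'M[R]_n) (g : 'S_n) i j :
  P *m perm_mx g = perm_mx g *m P -> P (g i) (g j) = P i j.
Proof.
by move/matrixP/(_ i (g j)); rewrite mulmx_permE permK -row_permE mxE.
Qed.

(** * Orthogonal decomposition into the spaces [Ud] *)

Section Components.

Variables (m : nat) (G : {group 'S_m.+1}).
Local Notation n := m.+1.
Implicit Types (d e : nat) (u v : 'rV[rat]_n).

Lemma coversP d e : covers G d e -> [/\ inD G d, inD G e, (e %| d)%N & (e < d)%N].
Proof. by case/and5P. Qed.

Lemma UdP k (A : 'M[rat]_(k, n)) d :
  reflect ((A <= Vper n d)%MS /\ forall e, covers G d e -> A *m Vper n e = 0)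
    (A <= Ud G d)%MS.
Proof.
rewrite sub_capmx; apply: (iffP andP) => -[AV AK]; split=> //.
  move=> e de; have [_ De _ _] := coversP de.
  have /sub_bigcapmxP := AK => /(_ (Ordinal (inD_leq De)) de)/sub_kermxP.
  by rewrite tr_Vper.
apply/sub_bigcapmxP => e de; apply/sub_kermxP; rewrite tr_Vper; exact: AK.
Qed.

(* The image lies in [V_gcd(d, e)], to which [U_e] is orthogonal. *)
Lemma Ud_mul_Vper0 d e u : inD G e -> inD G d -> ~~ (e %| d)%N ->
  (u <= Ud G e)%MS -> u *m Vper n d = 0.
Proof.
move=> De Dd ed /UdP[uV uK]; have dn := inD_dvdn Dd; have en := inD_dvdn De.
have Dg := inD_gcd De Dd; set g := gcdn e d in Dg.
have [|dt edt gdt] := covers_above De Dg (dvdn_gcdl _ _).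
  rewrite ltn_neqAle dvdn_leq ?dvdn_gcdl ?(inD_gt0 De) // andbT.
  by apply: contra ed => /eqP <-; apply: dvdn_gcdr.
have [_ Ddt dte _] := coversP edt.
have [w wE] : exists w, w = u *m Vper n d by eexists.
have we : (w <= Vper n e)%MS by rewrite wE; apply: mul_Vper_sub.
have wd_dt : (w *m Vper n d <= Vper n dt)%MS.
  apply: (Vper_mono gdt (inD_dvdn Ddt)); apply: Vper_gcd => //.
    exact: mul_Vper_sub.
  exact: submxMl.
(* The square norm of [w] is the scalar product of [u] with [w *m Vper n d], which lies in V_dt,
   where [e] covers [dt]. *)
rewrite -wE; apply: mulmx_tr_eq0; rewrite {1}wE -mulmxA.
have -> : Vper n d *m w^T = (w *m Vper n d)^T by rewrite trmx_mul tr_Vper.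
case/submxP: wd_dt => B ->.
by rewrite trmx_mul mulmxA tr_Vper uK // mul0mx.
Qed.

Lemma Ud_orth d e u v : inD G d -> inD G e -> d != e ->
  (u <= Ud G d)%MS -> (v <= Ud G e)%MS -> u *m v^T = 0.
Proof.
suff H d1 d2 (u1 u2 : 'rV_n) : inD G d1 -> inD G d2 -> ~~ (d1 %| d2)%N ->
    (u1 <= Ud G d1)%MS -> (u2 <= Ud G d2)%MS -> u1 *m u2^T = 0.
  move=> Dd De de ud ve; have [d_e|] := boolP (d %| e)%N; last by move/H; apply.
  have e_d : ~~ (e %| d)%N by apply: contra de => ed; rewrite eqn_dvd d_e.
  by apply: trmx_inj; rewrite trmx_mul trmxK trmx0; apply: H e_d ve ud.
move=> D1 D2 d12 u1U /UdP[/submxP[B ->] _].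
by rewrite trmx_mul tr_Vper mulmxA (Ud_mul_Vper0 D1 D2) // mul0mx.
Qed.

(** By induction the V_e with [e] covered by [d] lie in the sum, and the part of V_d orthogonal to
    all of them lies in U_d. *)
Lemma Vper_sub_sumUd d : inD G d ->
  (Vper n d <= \sum_(e < n.+1 | inD G e) Ud G e)%MS.
Proof.
elim/ltn_ind: d => d IH Dd.
pose S := (\sum_(e < n.+1 | covers G d e) Vper n e)%MS.
have SU : (S <= \sum_(e < n.+1 | inD G e) Ud G e)%MS.
  by apply/sumsmx_subP => e /coversP[_ De _ ltde]; apply: IH.
have SV : (S <= Vper n d)%MS.
  apply/sumsmx_subP => e /coversP[_ De ed _].
  by apply: (Vper_mono ed (inD_dvdn Dd)).
have /sub_addsmxP[[A B] /= VE] := orth_full S (Vper n d).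
rewrite VE; apply: addmx_sub; first by apply: submx_trans SU; apply: submxMl.
apply: (submx_trans _ (sumsmx_sup (Ordinal (inD_leq Dd)) _ (submx_refl _))) => //.
apply/UdP; split.
  have -> : B *m kermx S^T = Vper n d - A *m S by rewrite VE addrC addKr.
  by rewrite addmx_sub ?eqmx_opp //; apply: submx_trans SV; apply: submxMl.
move=> e de; have [_ De _ _] := coversP de.
have VeS : (Vper n e <= S)%MS by apply: (sumsmx_sup (Ordinal (inD_leq De))).
by rewrite -[Vper n e]tr_Vper; apply: (sub_kermx_trP VeS); apply: submxMl.
Qed.

Lemma sumUd_full k (A : 'M[rat]_(k, n)) :
  (A <= \sum_(e < n.+1 | inD G e) Ud G e)%MS.
Proof.
apply: submx_trans (Vper_sub_sumUd (inD_full G)); apply/VperP => // i j j'.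
by rewrite zres_eq zres_nat => /eqP ->.
Qed.

Lemma Ud_perm_stable d (g : 'S_n) : inD G d -> g \in G ->
  (Ud G d *m perm_mx g <= Ud G d)%MS.
Proof.
move=> Dd gG; have stab e h : inD G e -> h \in G -> (Vper n e *m perm_mx h <= Vper n e)%MS.
  by case/andP => _ /forallP/(_ h)/implyP; apply.
have /UdP[UV UK] := submx_refl (Ud G d); apply/UdP; split.
  by apply: submx_trans (stab d g Dd gG); apply: submxMr.
move=> e de; have [_ De _ _] := coversP de.
apply/sub_kermxP; rewrite -[Vper n e]tr_Vper.
apply: submx_trans (orth_perm_stable (stab e g^-1%g De _)); last by rewrite groupV.
by apply: submxMr; apply/sub_kermxP; rewrite tr_Vper; apply: UK.
Qed.

Lemma mxdirect_Ud (P : pred nat) : (forall d, P d -> inD G d) ->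
  mxdirect (\sum_(d < n.+1 | P d) Ud G d)%MS.
Proof.
move=> PD; apply/mxdirect_sumsP => d Pd; apply/eqP/rowV0P => v.
rewrite sub_capmx => /andP[vd /sub_sumsmxP[w vE]]; apply: mulmx_tr_eq0.
rewrite {2}vE linear_sum mulmx_sumr big1 // => e /andP[Pe ed] /=.
by apply: Ud_orth vd (submxMl _ _); [exact: PD | exact: PD | rewrite eq_sym].
Qed.

Section Scalar.

Variable f : int -> rat.
Hypothesis f_const : forall x y : int,
  (forall d, inD G d -> (d %| x)%Z = (d %| y)%Z) -> f x = f y.

(* By Moebius inversion over D(G), the circulant matrix is a combination of the
   matrices [Vper n d], each of which acts on [U_e] as a scalar. *)
Lemma circ_scalar_on_Ud e : inD G e -> exists c : rat,
  forall u, (u <= Ud G e)%MS -> u *m circ_mx m f = c *: u.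
Proof.
move=> De; have [E EP] := inD_max G.
pose scal (A : 'M[rat]_n) := exists c : rat,
  forall u, (u <= Ud G e)%MS -> u *m A = c *: u.
have scalD A B : scal A -> scal B -> scal (A + B).
  move=> [a aP] [b bP]; exists (a + b) => u uU.
  by rewrite mulmxDr aP // bP // scalerDl.
have scalZ a A : scal A -> scal (a *: A).
  move=> [b bP]; exists (a * b) => u uU.
  by rewrite -scalemxAr bP // scalerA.
have scal0 : scal 0 by exists 0 => u _; rewrite mulmx0 scale0r.
pose B d : 'M[rat]_n :=
  \matrix_(i, j) (E ((j : nat)%:Z - (i : nat)%:Z) == d)%:R.
have scalV d : inD G d -> scal (Vper n d).
  move=> Dd; have [ed|ed] := boolP (e %| d)%N.
    exists (n %/ d)%N%:R => u /UdP[uV _].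
    apply: mul_Vper_per; first exact: inD_dvdn Dd.
    exact: Vper_mono ed (inD_dvdn Dd) uV.
  by exists 0 => u uU; rewrite scale0r (Ud_mul_Vper0 De Dd).
(* [Vper n d] collects the [B l] with [d] dividing [l]; this relation is inverted by descending
   induction on [d]. *)
have VB d : inD G d -> Vper n d = \sum_(l < n.+1 | inD G l && (d %| l)%N) B l.
  move=> Dd; apply/matrixP => i j; rewrite VperE summxE.
  have [DE EE] := EP ((j : nat)%:Z - (i : nat)%:Z); rewrite EE //.
  have [dE|dE] := boolP (d %| _)%N; last first.
    rewrite big1 // => l /andP[_ dl]; rewrite mxE; case: eqP => // El.
    by rewrite El dl in dE.
  rewrite (bigD1 (Ordinal (inD_leq DE))) ?DE //= big1 ?addr0.
    by rewrite mxE eqxx.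
  move=> l /andP[_ lE]; rewrite mxE; case: eqP => // El.
  by case/eqP: lE; apply: val_inj.
have scalB d : inD G d -> scal (B d).
  have [N] := ubnP (n - d)%N; elim: N d => // N IH d dN Dd.
  have := VB d Dd; rewrite (bigD1 (Ordinal (inD_leq Dd))) ?Dd ?dvdnn //= => VE.
  have -> : B d = Vper n d - \sum_(l < n.+1 | inD G l && (d %| l)%N
      && (l != Ordinal (inD_leq Dd))) B l by rewrite VE addrK.
  apply: (scalD _ _ (scalV d Dd)).
  rewrite -scaleN1r; apply: scalZ.
  apply: (big_ind scal scal0 scalD) => l /andP[/andP[Dl dl] ld].
  have ltdl : (d < l)%N by rewrite ltn_neqAle dvdn_leq ?(inD_gt0 Dl) // andbT eq_sym.
  apply: IH => //; rewrite -ltnS; apply: leq_trans dN; rewrite ltnS; apply: ltn_sub2l => //.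
  by apply: leq_trans ltdl _; have := inD_leq Dl; rewrite ltnS.
have -> : circ_mx m f = \sum_(l < n.+1 | inD G l) f (l : nat)%:Z *: B l.
  apply/matrixP => i j; rewrite !mxE summxE.
  have [DE EE] := EP ((j : nat)%:Z - (i : nat)%:Z).
  rewrite (bigD1 (Ordinal (inD_leq DE))) ?DE //= big1 ?addr0.
    by rewrite !mxE eqxx mulr1; apply: f_const => d Dd; rewrite EE // dvdzE.
  move=> l /andP[_ lE]; rewrite !mxE; case: eqP => [El|]; last by rewrite mulr0.
  by case/eqP: lE; apply: val_inj.
apply: (big_ind scal scal0 scalD) => l Dl; apply: scalZ; exact: scalB.
Qed.

End Scalar.

Section Dichotomy.

Variable c : 'S_n.
Hypotheses (cG : c \in G) (cE : forall i : 'I_n, val (c i) = ((val i).+1 %% n)%N).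

Lemma cycle_expE (t : nat) (i : 'I_n) : (c ^+ t)%g i = zres m ((i : nat)%:Z + t%:Z).
Proof.
elim: t => [|t IHt]; first by rewrite expg0 perm1 addr0 zres_nat.
rewrite expgSr permM IHt; apply/eqP; rewrite -zres_eq [nat_of_ord _]cE.
set k := zres _ _; have kP : (n %| (k : nat)%:Z - ((i : nat)%:Z + t%:Z))%Z by apply: zresP.
have -> : ((k.+1 %% n)%N)%:Z - ((i : nat)%:Z + t.+1%:Z) =
   (((k.+1 %% n)%N)%:Z - k.+1%:Z) + ((k : nat)%:Z - ((i : nat)%:Z + t%:Z)).
  by rewrite !intS; ring.
by rewrite rpredD // -modn_dvdz modn_mod.
Qed.

(** The projector onto [W] commutes with [G], so it is an idempotent circulant and acts on U_e as a
    scalar, which must be [0] or [1] unless U_e vanishes. *)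
Lemma Ud_sub_or_orth (W : 'M[rat]_n) e :
    (forall g, g \in G -> (W *m perm_mx g <= W)%MS) -> inD G e ->
  (Ud G e <= W)%MS \/ (Ud G e <= kermx W^T)%MS.
Proof.
move=> Wstab De; pose P := proj_mx W (kermx W^T).
have Pcomm g : g \in G -> forall i j, P (g i) (g j) = P i j.
  move=> gG i j; apply: perm_comm_entry.
  by apply: proj_perm_comm; apply: Wstab; rewrite ?groupV.
pose f (z : int) := P (zres m 0) (zres m z).
have f_per (x y : int) : (n %| x - y)%Z -> f x = f y.
  by rewrite eq_zres /f => /eqP ->.
have PE i j : P i j = f ((j : nat)%:Z - (i : nat)%:Z).
  rewrite /f -[RHS](Pcomm (c ^+ (i : nat))%g) ?groupX // !cycle_expE; congr (P _ _).
    by apply/eqP; rewrite -zres_eq -rpredN opprB addrK; have := zresP m 0; rewrite subr0.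
  apply/eqP; rewrite -zres_eq.
  set k := zres _ _; have := zresP m ((j : nat)%:Z - (i : nat)%:Z); rewrite -/k.
  have -> : (j : nat)%:Z - ((k : nat)%:Z + (i : nat)%:Z) =
    - ((k : nat)%:Z - ((j : nat)%:Z - (i : nat)%:Z)) by ring.
  by rewrite rpredN.
have circE : circ_mx m f = P by apply/matrixP => i j; rewrite mxE PE.
have PP : P *m P = P by apply: proj_mx_proj; apply: orth_cap0.
have [|a aP] := circ_scalar_on_Ud (f := f) _ De.
  apply: circ_block_const => //; last by rewrite circE.
  by move=> g gG i j; rewrite -!PE Pcomm.
rewrite circE in aP.
have [/eqP U0|/rowV0Pn[v vU v0]] := boolP (Ud G e == 0).
  by left; rewrite U0 sub0mx.
have : a *: v = (a * a) *: v.
  by rewrite -(aP v vU) -PP mulmxA (aP v vU) -scalemxAl (aP v vU) scalerA.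
move/eqP; rewrite -subr_eq0 -scalerBl scaler_eq0 (negPf v0) orbF.
rewrite -{1}[a]mulr1 -mulrBr mulf_eq0 subr_eq0 => /orP[] /eqP a01.
  right; apply/rV_subP => u uU.
  have := aP u uU; rewrite a01 scale0r => uP.
  by rewrite -[u]subr0 -uP; apply: proj_mx_compl_sub; apply: orth_full.
left; apply/rV_subP => u uU; have := aP u uU; rewrite -a01 scale1r => <-.
exact: proj_mx_sub.
Qed.

End Dichotomy.

End Components.

(** * Fourier support of the spaces [Ud] *)

Section Contribution.

Variables (m : nat) (G : {group 'S_m.+1}).
Local Notation n := m.+1.
Implicit Types (d e : nat) (u : 'rV[rat]_n).

Lemma conj_eps_primitive : n.-primitive_root (eps n)^*.
Proof. by rewrite fmorph_primitive_root eps_primitive. Qed.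

Lemma hprodE u r : hprod u r = \sum_(k < n) ratr (u 0 k) * ((eps n)^* ) ^+ (k * r).
Proof. by apply: eq_bigr => k _; rewrite rmorphXn. Qed.

Lemma hprod0 r : hprod (0 : 'rV[rat]_n) r = 0.
Proof. by rewrite /hprod big1 // => k _; rewrite mxE rmorph0 mul0r. Qed.

Lemma hprod_sum (I : finType) (P : pred I) (F : I -> 'rV[rat]_n) r :
  hprod (\sum_(i | P i) F i) r = \sum_(i | P i) hprod (F i) r.
Proof.
rewrite /hprod exchange_big /=; apply: eq_bigr => k _.
by rewrite summxE rmorph_sum mulr_suml.
Qed.

Lemma hprod_neq0 u : u != 0 ->
  exists r : 'I_n.+1, (0 < r)%N /\ hprod u r != 0.
Proof.
move=> u0; apply: boolp.contrapT => H; case/eqP: u0; apply/rowP => k; rewrite mxE.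
apply: (fmorph_inj (ratr : rat -> algC)); rewrite rmorph0.
apply: (fourier_inj conj_eps_primitive (a := fun k => ratr (u 0 k))) => r rn.
rewrite -hprodE; apply/eqP; apply: contraT => ur; case: H.
have [r0|r_gt0] := posnP r; last by exists (Ordinal (ltnW rn : r < n.+1)%N).
(* Frequency [0] is represented by [n], as frequencies range over [1..n]. *)
exists ord_max; split=> //; move: ur; rewrite r0 !hprodE /=.
congr (_ != _); apply: eq_bigr => l _; rewrite muln0 mulnC exprM.
by rewrite (prim_expr_order conj_eps_primitive) expr1n.
Qed.

Lemma dvdn_codivisor d r : inD G d -> (n %/ d %| r)%N = (n %| d * r)%N.
Proof. by move=> Dd; rewrite dvdn_divLR ?(inD_gt0 Dd) ?(inD_dvdn Dd) // mulnC. Qed.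

(** Periodicity gives [H = H * z ^+ (e * r)], so [n] divides [e * r]. If [n] divided [dt * r] for a
    covered [dt], then [n / dt] times [H] would be the transform of [u *m Vper n dt = 0]. *)
Lemma hprod_Ud_inPsi e u r : inD G e -> (u <= Ud G e)%MS -> hprod u r != 0 -> inPsi G e r.
Proof.
move=> De /UdP[/(VperP _ (ltn0Sn m) (inD_dvdn De)) uper uK]; rewrite hprodE.
set z := (eps n)^*; have zP : n.-primitive_root z := conj_eps_primitive.
set H := \sum_(k < n) _ => H0; apply/andP; split.
  rewrite dvdn_codivisor // (prim_order_dvd zP).
  have HE : H = H * z ^+ (e * r).
    rewrite {1}/H (reindex_inj (@zres_addK_inj m e%:Z)) /= mulr_suml.
    apply: eq_bigr => k _; set k' := zres _ _.
    have k'P : (n %| (k' : nat)%:Z - ((k : nat)%:Z + e%:Z))%Z by apply: zresP.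
    have -> : u 0 k' = u 0 k.
      apply: uper; rewrite dvdz_zres ?(inD_dvdn De) //.
      by rewrite addrAC subrr add0r.
    rewrite -mulrA -exprD -mulnDl; congr (_ * _); apply: (prim_root_congr zP).
    by rewrite !PoszM -mulrBl dvdz_mulr // PoszD.
  by rewrite -(inj_eq (mulfI H0)) mulr1 -HE.
apply/forallP => dt; apply/implyP => edt; have [_ Ddt _ _] := coversP edt.
rewrite dvdn_codivisor //; apply: contra H0 => ndt.
have dtn := inD_dvdn Ddt.
have c0 : (n %/ dt)%N%:R != 0 :> algC.
  have dt_gt0 := inD_gt0 Ddt; have dt_le := dvdn_leq (ltn0Sn m) dtn.
  by rewrite pnatr_eq0 -lt0n divn_gt0.
rewrite -(inj_eq (mulfI c0)) mulr0; apply/eqP.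
have -> : (n %/ dt)%N%:R * H =
    \sum_(j < n) ratr ((u *m Vper n dt) 0 j) * z ^+ (j * r).
  under [RHS]eq_bigr => j _ do rewrite mxE rmorph_sum mulr_suml.
  rewrite exchange_big /= mulr_sumr; apply: eq_bigr => k _.
  have <- : ratr ((n %/ dt)%N%:R) = (n %/ dt)%N%:R :> algC by rewrite ratr_nat.
  rewrite -(sum_Vper k dtn) rmorph_sum mulr_suml; apply: eq_bigr => j _.
  rewrite rmorphM /= !VperE -[in RHS]rpredN opprB.
  case: (boolP (_ \in _)) => [jk|_]; last by rewrite rmorph0 !(mul0r, mulr0).
  rewrite rmorph1 mul1r mulr1; congr (_ * _); apply: (prim_root_congr zP).
  rewrite !PoszM -mulrBl; case/dvdzP: jk => q ->.
  by rewrite -mulrA dvdz_mull // -PoszM dvdzE.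
by rewrite uK // big1 // => j _; rewrite mxE rmorph0 mul0r.
Qed.

(** Unless [d1] divides [d2], their gcd divides some [dt] covered by [d1]; then [n / dt] divides
    [r], against [inPsi G d1 r]. *)
Lemma inPsi_inj d e r : inD G d -> inD G e -> inPsi G d r -> inPsi G e r -> d = e.
Proof.
suff H d1 d2 : inD G d1 -> inD G d2 -> inPsi G d1 r -> inPsi G d2 r -> (d1 %| d2)%N.
  by move=> Dd De Pd Pe; apply/eqP; rewrite eqn_dvd !H.
move=> D1 D2 /andP[r1 /forallP P1] /andP[r2 _]; apply: contraT => d12.
have Dg := inD_gcd D1 D2; set g := gcdn d1 d2 in Dg.
have [|dt cdt gdt] := covers_above D1 Dg (dvdn_gcdl _ _).
  rewrite ltn_neqAle dvdn_leq ?dvdn_gcdl ?(inD_gt0 D1) // andbT.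
  by apply: contra d12 => /eqP <-; apply: dvdn_gcdr.
have [_ Ddt _ _] := coversP cdt.
have /implyP/(_ cdt) := P1 (Ordinal (inD_leq Ddt)).
rewrite /= dvdn_codivisor //; case/negP.
apply: (@dvdn_trans (g * r)); last by rewrite dvdn_mul.
by rewrite /g muln_gcdl dvdn_gcd -!dvdn_codivisor // r1.
Qed.

(** At frequencies in Psi_d only the component [F d] is seen, and a nonzero [F d] has a nonzero
    coefficient, necessarily at such a frequency. *)
Lemma contributes_neq0 (delta : 'rV[rat]_n) (F : 'I_n.+1 -> 'rV[rat]_n) (d : 'I_n.+1) :
    delta = \sum_(e < n.+1 | inD G e) F e ->
    (forall e : 'I_n.+1, (F e <= Ud G e)%MS) -> inD G d ->
  contributes G delta d = (F d != 0).
Proof.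
move=> deltaE FU Dd; have hE (r : nat) : inPsi G d r -> hprod delta r = hprod (F d) r.
  move=> Pr; rewrite deltaE hprod_sum (bigD1 d) //= big1 ?addr0 // => e /andP[De ed].
  apply/eqP; apply: contraT => /(hprod_Ud_inPsi De (FU e)) Per.
  by case/eqP: ed; apply: val_inj; apply: inPsi_inj Per Pr.
rewrite /contributes Dd /=; apply/existsP/idP => [[r /and3P[_ Pr]]|Fd].
  by rewrite hE //; apply: contraNneq => ->; rewrite hprod0.
have [r [r_gt0 hr]] := hprod_neq0 Fd; exists r.
have Pr := hprod_Ud_inPsi Dd (FU d) hr.
by rewrite r_gt0 Pr hE.
Qed.

End Contribution.

(** * The invariant subspace generated by [delta] *)

Lemma Vdelta_stable (n : nat) (G : {group 'S_n}) (delta : 'rV[rat]_n) (g : 'S_n) :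
  g \in G -> (Vdelta G delta *m perm_mx g <= Vdelta G delta)%MS.
Proof.
move=> gG; rewrite /Vdelta sumsmxMr; apply/sumsmx_subP => h hG.
apply: (sumsmx_sup (h * g)%g); first exact: groupM.
by rewrite perm_mxM mulmxA genmxE (eqmxMr _ (genmxE _)).
Qed.

Lemma Vdelta_mem (n : nat) (G : {group 'S_n}) (delta : 'rV[rat]_n) :
  (delta <= Vdelta G delta)%MS.
Proof.
apply: (sumsmx_sup 1%g); first exact: group1.
by rewrite perm_mx1 mulmx1 genmxE.
Qed.

Lemma Vdelta_min (n : nat) (G : {group 'S_n}) (delta : 'rV[rat]_n) (W : 'M[rat]_n) :
    (forall g, g \in G -> (W *m perm_mx g <= W)%MS) -> (delta <= W)%MS ->
  (Vdelta G delta <= W)%MS.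
Proof.
move=> Wstab dW; apply/sumsmx_subP => g gG; rewrite genmxE.
by apply: submx_trans (Wstab g gG); apply: submxMr.
Qed.

Unset Implicit Arguments.

Theorem theorem4 (n : nat) (G : {group 'S_n}) (delta : 'rV[rat]_n) :
  (0 < n)%N ->
  (exists2 c : 'S_n, c \in G & forall i : 'I_n, val (c i) = ((val i).+1 %% n)%N) ->
  mxdirect (\sum_(d < n.+1 | contributes G delta d) Ud G d)%MS /\
  (Vdelta G delta == \sum_(d < n.+1 | contributes G delta d) Ud G d)%MS.
Proof.
case: n G delta => // m G delta _ [c cG cE].
have contribD d : contributes G delta d -> inD G d by case/andP.
split; first exact: mxdirect_Ud.
have /sub_sumsmxP[A deltaE] := sumUd_full G delta.
pose F (e : 'I_m.+2) := A e *m Ud G e.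
have FU e : (F e <= Ud G e)%MS by apply: submxMl.
have contribE (d : 'I_m.+2) : inD G d -> contributes G delta d = (F d != 0).
  exact: contributes_neq0.
apply/andP; split.
  apply: Vdelta_min.
    move=> g gG; rewrite sumsmxMr; apply/sumsmx_subP => d cd.
    by apply: (sumsmx_sup d) => //; apply: Ud_perm_stable; first exact: contribD.
  rewrite [X in (X <= _)%MS]deltaE; apply: summx_sub => d Dd; rewrite -/(F d); have [->|Fd] := eqVneq (F d) 0.
    exact: sub0mx.
  by apply: (sumsmx_sup d); [rewrite contribE | apply: FU].
apply/sumsmx_subP => d cd; have Dd := contribD d cd.
(* If U_d is orthogonal to [Vdelta], then [F d] is orthogonal to [delta], so its own square norm
   vanishes; but [d] contributes. *)
have [//|UK] := Ud_sub_or_orth cG cE (Vdelta_stable (G := G) delta) Dd.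
move: cd; rewrite contribE // => /eqP[]; apply: mulmx_tr_eq0.
have FK : (F d <= kermx (Vdelta G delta)^T)%MS by apply: submx_trans UK.
have := sub_kermx_trP (Vdelta_mem G delta) FK.
rewrite {1}deltaE linear_sum mulmx_sumr (bigD1 d) //= big1 ?addr0 // => e /andP[De ed].
by apply: Ud_orth (FU d) (FU e) => //; rewrite eq_sym.
Qed.
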